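(* Let $M$ be a strongly regular sequence and let $\gamma$ be a real number with $0<\gamma<\gamma(M)$. There exist a function $G$ belonging to $\mathcal{A}_M(S_\gamma)$ and positive constants $\kappa_1,\kappa_2,\kappa_3$, depending only on $M$ and $\gamma$, such that, for any $z\in S_\gamma$, $$\kappa_1 h_M(\kappa_2|z|)\leq |G(z)|\leq h_M(\kappa_3|z|).$$
   Context: A sequence $M=(M_j)_{j\geq 0}$ of real numbers is \emph{strongly regular} if, for some constant $A>0$: (1) $M_0=1$ and $M$ is non-decreasing; (2) $M$ is logarithmically convex, i.e. the quotients $m_j=M_{j+1}/M_j$ form a non-decreasing sequence; (3) $M_{j+k}\leq A^{j+k}M_jM_k$ for all $j,k\in\mathbb{N}$; (4) $\sum_{j\geq \ell}\frac{M_j}{(j+1)M_{j+1}}\leq A\frac{M_\ell}{M_{\ell+1}}$ for all $\ell\in\mathbb{N}$. Here $\mathbb{N}=\{0,1,2,\dots\}$. The sequence $m=(m_j)_{j\ge 0}$ is the sequence of quotients of $M$. For real $\gamma>0$, $M$ satisfies property $(\mathsf{P}_\gamma)$ if there exist a sequence $m'=(m'_j)_{j\geq 0}$ and a constant $a\geq 1$ such that $(j+1)^{-\gamma}m'_j$ increases (is non-decreasing in $j$) and $a^{-1}m_j\leq m'_j\leq a m_j$ for all $j\in\mathbb{N}$. The growth index of $M$ is $\gamma(M)=\sup\{\gamma : (\mathsf{P}_\gamma)\text{ holds}\}$; it is known that $0<\gamma(M)<\infty$. The function $h_M$ is defined on $[0,\infty)$ by $h_M(t)=\inf_{j\geq 0}t^jM_j$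 for $t>0$ and $h_M(0)=0$. $\Sigma$ denotes the Riemann surface of the logarithm, $\operatorname{Arg}$ the principal determination of the argument on it, and $S_\gamma=\{z\in\Sigma : |\operatorname{Arg} z|<\gamma\pi/2\}$ (for $\gamma<2$ this is an open sector in $\mathbb{C}$). $\mathcal{A}_M(S_\gamma)$ is the space of holomorphic functions $f$ on $S_\gamma$ for which there are constants $C,\sigma>0$ with $|f^{(j)}(z)|\leq C\sigma^j j!M_j$ for all $j\in\mathbb{N}$ and $z\in S_\gamma$. *)

(* Defs.v *)
From Stdlib Require Import Reals Factorial.
From Coquelicot Require Import Coquelicot.

Open Scope R_scope.

Definition quotient (M : nat -> R) (j : nat) : R := M (S j) / M j.

Definition strongly_regular (M : nat -> R) : Prop :=
  exists A : R, 0 < A /\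
    (M 0%nat = 1 /\ forall j, M j <= M (S j)) /\
    (forall j, quotient M j <= quotient M (S j)) /\
    (forall j k, M (j + k)%nat <= A ^ (j + k) * M j * M k) /\
    (* [Series] is only meaningful for convergent series, hence [ex_series];
       the index is shifted so that the sum runs over j >= l. *)
    (forall l,
       let term j := M j / (INR (j + 1) * M (j + 1)%nat) in
       ex_series (fun k => term (l + k)%nat) /\
       Series (fun k => term (l + k)%nat) <= A * (M l / M (l + 1)%nat)).

Definition property_P (M : nat -> R) (gamma : R) : Prop :=
  exists (m' : nat -> R) (a : R), 1 <= a /\
    (forall j, Rpower (INR (j + 1)) (- gamma) * m' j
               <= Rpower (INR (S j + 1)) (- gamma) * m' (S j)) /\
    (forall j, / a * quotient M j <= m' j <= a * quotient M j).

Definition growth_index (M : nat -> R) : Rbar :=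
  Lub_Rbar (fun gamma => 0 < gamma /\ property_P M gamma).

(* Only used at t >= 0.  The infimum is finite whenever M is nonnegative. *)
Definition h (M : nat -> R) (t : R) : R :=
  if Rlt_dec 0 t then real (Inf_seq (fun j => Finite (t ^ j * M j))) else 0.

(* The Riemann surface of the logarithm in polar coordinates: its points are
   the pairs (r, theta) with r > 0, and theta is not taken modulo 2 PI.  The
   condition r > 0 is imposed by the (open) subsets below. *)
Definition Sigma : UniformSpace :=
  prod_UniformSpace R_UniformSpace R_UniformSpace.

Definition modulus (z : Sigma) : R := fst z.
Definition Arg (z : Sigma) : R := snd z.

Definition proj (z : Sigma) : C :=
  (modulus z * cos (Arg z), modulus z * sin (Arg z)).

Definition sector (gamma : R) (z : Sigma) : Prop :=
  0 < modulus z /\ Rabs (Arg z) < gamma * PI / 2.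

(* Complex derivative with respect to the local coordinate [proj], which is a
   local homeomorphism from the surface onto C minus the origin. *)
Definition is_Sderive (f : Sigma -> C) (z : Sigma) (l : C) : Prop :=
  filterlim (fun x : Sigma => ((f x - f z) / (proj x - proj z))%C)
    (locally' z) (@locally C_UniformSpace l).

Definition holomorphic_on (U : Sigma -> Prop) (f : Sigma -> C) : Prop :=
  forall z, U z -> exists l, is_Sderive f z l.

(* D j is the j-th derivative of f on U; for U open it is unique on U. *)
Definition derivatives_on (U : Sigma -> Prop) (f : Sigma -> C)
    (D : nat -> Sigma -> C) : Prop :=
  (forall z, U z -> D 0%nat z = f z) /\
  (forall j z, U z -> is_Sderive (D j) z (D (S j) z)).

(* The space A_M(U). *)
Definition ultraholomorphic (M : nat -> R) (U : Sigma -> Prop)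
    (f : Sigma -> C) : Prop :=
  holomorphic_on U f /\
  exists D, derivatives_on U f D /\
    exists c sigma : R, 0 < c /\ 0 < sigma /\
      forall j z, U z -> Cmod (D j z) <= c * sigma ^ j * INR (fact j) * M j.

(* Main.v *)
Require Import Defs.
From Stdlib Require Import Reals Factorial Lra Lia Psatz.
From Coquelicot Require Import Coquelicot.

Open Scope R_scope.

(** Pick [gamma < gam < gamma'] with [(P_gamma')] and let [a_j = m_j^(-1/gam)], so
that [(P_gamma')] bounds the tails of [sum a_j] by a multiple of [(N + 1) a_N].
The function is [G(z) = prod_j (1 + a_j z^(-1/gam))^(-gam)].  On [S_gam] the
terms [p_j = a_j z^(-1/gam)] have positive real part and modulus
[(|z| m_j)^(-1/gam)], so [|1 + p_j| >= max(1, |p_j|)] gives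
[|G(z)| <= |z|^n M_n] for every [n].  For the lower bound, take [N] least with
[|p_N| <= 1]: the first [N] factors cost a constant each, absorbed in [kappa2],
and the tail bound costs [exp(-gam K (N + 1))].  The derivatives on [S_gamma] are
bounded by Cauchy's formula on circles of radius comparable to [|z|], which stay
in [S_gam]. *)

(** * Uniform complex differentiability *)

(** All analysis takes place in the coordinate [s = log z]. There the sector is a strip,
    [z^(-1/gam)] is [exp(-s/gam)], and openings of 2 or more involve no choice of branch. Complex
    differentiability is carried as a quadratic remainder whose constant is uniform on a set, a form
    that passes through series and integrals by adding up bounds. Cauchy's formula is built on it,
    from the constancy of circular means in the radius. The exponent [gam] has room on both sides:
    [gam < gamma'] makes the decay exponent [gamma'/gam] of the tails exceed 1, and [gamma < gam]
    leaves space for the circles. Since [m_j = a_j^(-gam)], the power [|p_j|^(-gam)] is exactly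
    [|z| m_j], and its product over [j < n] is [|z|^n M_n]. With [n] the order of the derivative,
    this [|z|^n] cancels the [|z|^(-n)] of Cauchy's estimate, so that [n! M_n] remains, uniformly up
    to the vertex. Constants that degenerate at the vertex enter only where differentiability is
    asserted, and there they may depend on the point. *)

Lemma im_le_Cmod (c : C) : Rabs (Im c) <= Cmod c.
Proof. eapply Rle_trans; [apply Rmax_r | apply Rmax_Cmod]. Qed.

Lemma Cmod_le_parts (c : C) (B : R) :
  Rabs (Re c) <= B -> Rabs (Im c) <= B -> Cmod c <= 2 * B.
Proof.
  intros Hr Hi.
  replace c with (RtoC (Re c) + Ci * RtoC (Im c))%C
    by (apply injective_projections; unfold Re, Im; simpl; ring).
  eapply Rle_trans; [apply Cmod_triangle|].
  rewrite Cmod_mult, Cmod_Ci, !Cmod_R; lra.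
Qed.

(** The mean value theorem has no exact analogue for complex values; it is applied to the real and
    imaginary parts separately, which costs the factor 2. *)
Lemma segment_mean_value (phi psi : R -> C) (B : R) :
  (forall t, 0 <= t <= 1 ->
     is_derive (fun x => Re (phi x)) t (Re (psi t)) /\
     is_derive (fun x => Im (phi x)) t (Im (psi t)) /\ Cmod (psi t) <= B) ->
  Cmod (phi 1 - phi 0) <= 2 * B.
Proof.
  intros H.
  assert (aux : forall u du : R -> R,
    (forall t, 0 <= t <= 1 -> is_derive u t (du t) /\ Rabs (du t) <= B) ->
    Rabs (u 1 - u 0) <= B).
  { intros u du Hu.
    destruct (MVT_gen u 0 1 du) as [c [Hc E]].
    - intros x Hx. rewrite Rmin_left, Rmax_right in Hx by lra. apply Hu; lra.
    - intros x Hx. rewrite Rmin_left, Rmax_right in Hx by lra.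
      apply continuity_pt_filterlim, (ex_derive_continuous (V := R_NormedModule)).
      exists (du x); apply Hu; lra.
    - rewrite Rmin_left, Rmax_right in Hc by lra.
      rewrite E, Rminus_0_r, Rmult_1_r. apply Hu, Hc. }
  apply Cmod_le_parts.
  - apply (aux (fun x => Re (phi x)) (fun x => Re (psi x))).
    intros t Ht; destruct (H t Ht) as (H1 & _ & H3); split; [exact H1|].
    eapply Rle_trans; [apply re_le_Cmod | exact H3].
  - apply (aux (fun x => Im (phi x)) (fun x => Im (psi x))).
    intros t Ht; destruct (H t Ht) as (_ & H2 & H3); split; [exact H2|].
    eapply Rle_trans; [apply im_le_Cmod | exact H3].
Qed.

(* Complex differentiability with a quadratic remainder that is uniform on an
   arbitrary set [U]; taking for [U] the real axis, it covers curves as well. *)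
Definition C11 (U : C -> Prop) (f f' : C -> C) : Prop :=
  exists K : R, 0 <= K /\ forall s, U s -> Cmod (f' s) <= K /\
    forall s', U s' ->
      Cmod (f s' - f s) <= K * Cmod (s' - s) /\
      Cmod (f s' - f s - f' s * (s' - s)) <= K * Cmod (s' - s) ^ 2.

Definition bounded_on (U : C -> Prop) (f : C -> C) : Prop :=
  exists K : R, 0 <= K /\ forall s, U s -> Cmod (f s) <= K.

Definition lipschitz_on (U : C -> Prop) (f : C -> C) : Prop :=
  exists K : R, 0 <= K /\
    forall s s', U s -> U s' -> Cmod (f s' - f s) <= K * Cmod (s' - s).

Lemma C11_subset (U V : C -> Prop) f f' :
  (forall s, V s -> U s) -> C11 U f f' -> C11 V f f'.
Proof.
  intros HS (K & HK & H). exists K; split; [exact HK|].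
  intros s Hs. destruct (H s (HS _ Hs)) as [H1 H2]; split; auto.
Qed.

Lemma C11_ext (U : C -> Prop) f g f' g' :
  (forall s, U s -> f s = g s) -> (forall s, U s -> f' s = g' s) ->
  C11 U f f' -> C11 U g g'.
Proof.
  intros Hf Hf' (K & HK & H). exists K; split; [exact HK|].
  intros s Hs. destruct (H s Hs) as [H1 H2]. rewrite <- (Hf' s Hs).
  split; [exact H1|]. intros s' Hs'. rewrite <- (Hf s Hs), <- (Hf s' Hs'); auto.
Qed.

Lemma C11_bounded_derivative U f f' : C11 U f f' -> bounded_on U f'.
Proof. intros (K & HK & H); exists K; split; [exact HK|]. intros s Hs; apply H, Hs. Qed.

Lemma C11_lipschitz U f f' : C11 U f f' -> lipschitz_on U f.
Proof. intros (K & HK & H); exists K; split; [exact HK|]. intros s s' Hs Hs'; apply H; auto. Qed.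

(* Add the Taylor estimates at [s] and at [s']. *)
Lemma C11_lipschitz_derivative U f f' : C11 U f f' -> lipschitz_on U f'.
Proof.
  intros (K & HK & H); exists (2 * K); split; [lra|].
  intros s s' Hs Hs'.
  destruct (H s Hs) as [_ H1]; destruct (H1 s' Hs') as [_ H2].
  destruct (H s' Hs') as [_ H3]; destruct (H3 s Hs) as [_ H4].
  assert (E : Cmod (s - s') = Cmod (s' - s)).
  { replace (s - s')%C with (- (s' - s))%C by ring. apply Cmod_opp. }
  rewrite E in H4.
  assert (H5 : Cmod (f' s' - f' s) * Cmod (s' - s) <= 2 * K * Cmod (s' - s) * Cmod (s' - s)).
  { rewrite <- Cmod_mult.
    replace ((f' s' - f' s) * (s' - s))%C with
      ((f s' - f s - f' s * (s' - s)) + (f s - f s' - f' s' * (s - s')))%C by ring.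
    eapply Rle_trans; [apply Cmod_triangle|]. simpl in H2, H4. nra. }
  destruct (Req_dec (Cmod (s' - s)) 0) as [Z|Z].
  - apply Cmod_eq_0 in Z.
    replace s' with (s + (s' - s))%C by ring. rewrite Z.
    replace (s + 0)%C with s by ring. replace (f' s - f' s)%C with (RtoC 0) by ring.
    rewrite Cmod_0. pose proof (Cmod_ge_0 (s - s)). nra.
  - apply Rmult_le_reg_r with (Cmod (s' - s)); [pose proof (Cmod_ge_0 (s' - s)); lra|lra].
Qed.

Lemma C11_affine (U : C -> Prop) (a b : C) :
  C11 U (fun s => a * s + b)%C (fun _ => a).
Proof.
  exists (Cmod a); split; [apply Cmod_ge_0|]. intros s _; split; [lra|]. intros s' _; split.
  - rewrite <- Cmod_mult. right; f_equal; ring.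
  - replace (a * s' + b - (a * s + b) - a * (s' - s))%C with (RtoC 0) by ring.
    rewrite Cmod_0. apply Rmult_le_pos; [apply Cmod_ge_0 | apply pow2_ge_0].
Qed.

(** [C11] bounds the derivative but not the function, and [U] may be unbounded; hence the two
    boundedness hypotheses. *)
Lemma C11_mult (U : C -> Prop) f f' g g' :
  bounded_on U f -> bounded_on U g -> C11 U f f' -> C11 U g g' ->
  C11 U (fun s => f s * g s)%C (fun s => f' s * g s + f s * g' s)%C.
Proof.
  intros (A & HA & Hf) (B & HB & Hg) (K & HK & Kf) (L & HL & Lg).
  exists (K * B + A * L + K * L); split; [nra|].
  intros s Hs.
  destruct (Kf s Hs) as [K1 K2]; destruct (Lg s Hs) as [L1 L2].
  pose proof (Hf s Hs) as Hfs; pose proof (Hg s Hs) as Hgs.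
  pose proof (Cmod_ge_0 (f s)); pose proof (Cmod_ge_0 (g s)).
  pose proof (Cmod_ge_0 (f' s)); pose proof (Cmod_ge_0 (g' s)).
  split.
  - eapply Rle_trans; [apply Cmod_triangle|]. rewrite !Cmod_mult. nra.
  - intros s' Hs'. destruct (K2 s' Hs') as [K3 K4]; destruct (L2 s' Hs') as [L3 L4].
    pose proof (Hg s' Hs') as Hgs'. pose proof (Hf s' Hs') as Hfs'.
    set (d := Cmod (s' - s)) in *.
    pose proof (Cmod_ge_0 (s' - s)) as Hd; fold d in Hd.
    split.
    + replace (f s' * g s' - f s * g s)%C with ((f s' - f s) * g s' + f s * (g s' - g s))%C by ring.
      eapply Rle_trans; [apply Cmod_triangle|]. rewrite !Cmod_mult.
      assert (Cmod (f s' - f s) * Cmod (g s') <= K * d * B)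
        by (apply Rmult_le_compat; auto using Cmod_ge_0).
      assert (Cmod (f s) * Cmod (g s' - g s) <= A * (L * d))
        by (apply Rmult_le_compat; auto using Cmod_ge_0).
      assert (0 <= K * L * d) by (apply Rmult_le_pos; nra). lra.
    + replace (f s' * g s' - f s * g s - (f' s * g s + f s * g' s) * (s' - s))%C with
        ((f s' - f s - f' s * (s' - s)) * g s + f s * (g s' - g s - g' s * (s' - s))
         + (f s' - f s) * (g s' - g s))%C by ring.
      eapply Rle_trans; [apply Cmod_triangle|].
      eapply Rle_trans; [apply Rplus_le_compat_r, Cmod_triangle|]. rewrite !Cmod_mult.
      assert (Cmod (f s' - f s - f' s * (s' - s)) * Cmod (g s) <= K * d ^ 2 * B)
        by (apply Rmult_le_compat; auto using Cmod_ge_0).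
      assert (Cmod (f s) * Cmod (g s' - g s - g' s * (s' - s)) <= A * (L * d ^ 2))
        by (apply Rmult_le_compat; auto using Cmod_ge_0).
      assert (Cmod (f s' - f s) * Cmod (g s' - g s) <= K * d * (L * d))
        by (apply Rmult_le_compat; auto using Cmod_ge_0).
      lra.
Qed.

Lemma C11_comp (U V : C -> Prop) f f' g g' :
  (forall s, U s -> V (f s)) -> C11 U f f' -> C11 V g g' ->
  C11 U (fun s => g (f s)) (fun s => g' (f s) * f' s)%C.
Proof.
  intros HUV (K & HK & Kf) (L & HL & Lg).
  exists (L * K + L * K ^ 2); split; [nra|].
  intros s Hs.
  destruct (Kf s Hs) as [K1 K2]; destruct (Lg (f s) (HUV s Hs)) as [L1 L2].
  assert (0 <= L * K) by nra. assert (0 <= L * K ^ 2) by nra.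
  split.
  - rewrite Cmod_mult.
    assert (Cmod (g' (f s)) * Cmod (f' s) <= L * K)
      by (apply Rmult_le_compat; auto using Cmod_ge_0). lra.
  - intros s' Hs'. destruct (K2 s' Hs') as [K3 K4].
    destruct (L2 (f s') (HUV s' Hs')) as [L3 L4].
    set (d := Cmod (s' - s)) in *.
    pose proof (Cmod_ge_0 (s' - s)) as Hd; fold d in Hd.
    pose proof (Cmod_ge_0 (f s' - f s)) as He.
    assert (Hd2 : 0 <= d ^ 2) by apply pow2_ge_0.
    split.
    + assert (L * Cmod (f s' - f s) <= L * (K * d)) by (apply Rmult_le_compat_l; auto). nra.
    + replace (g (f s') - g (f s) - g' (f s) * f' s * (s' - s))%C with
        ((g (f s') - g (f s) - g' (f s) * (f s' - f s))
         + g' (f s) * (f s' - f s - f' s * (s' - s)))%C by ring.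
      eapply Rle_trans; [apply Cmod_triangle|]. rewrite Cmod_mult.
      assert (Cmod (g' (f s)) * Cmod (f s' - f s - f' s * (s' - s)) <= L * (K * d ^ 2))
        by (apply Rmult_le_compat; auto using Cmod_ge_0).
      assert (L * Cmod (f s' - f s) ^ 2 <= L * (K * d) ^ 2)
        by (apply Rmult_le_compat_l; auto; apply pow_incr; auto).
      nra.
Qed.

Lemma bounded_on_mult U f g :
  bounded_on U f -> bounded_on U g -> bounded_on U (fun s => f s * g s)%C.
Proof.
  intros (A & HA & Hf) (B & HB & Hg). exists (A * B); split; [nra|].
  intros s Hs. rewrite Cmod_mult. apply Rmult_le_compat; auto using Cmod_ge_0.
Qed.

Lemma lipschitz_on_mult U f g :
  bounded_on U f -> bounded_on U g -> lipschitz_on U f -> lipschitz_on U g ->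
  lipschitz_on U (fun s => f s * g s)%C.
Proof.
  intros (A & HA & Hf) (B & HB & Hg) (K & HK & Kf) (L & HL & Lg).
  exists (K * B + A * L); split; [nra|]. intros s s' Hs Hs'.
  replace (f s' * g s' - f s * g s)%C with ((f s' - f s) * g s' + f s * (g s' - g s))%C by ring.
  eapply Rle_trans; [apply Cmod_triangle|]. rewrite !Cmod_mult.
  assert (Cmod (f s' - f s) * Cmod (g s') <= K * Cmod (s' - s) * B)
    by (apply Rmult_le_compat; auto using Cmod_ge_0).
  assert (Cmod (f s) * Cmod (g s' - g s) <= A * (L * Cmod (s' - s)))
    by (apply Rmult_le_compat; auto using Cmod_ge_0).
  lra.
Qed.

Lemma lipschitz_on_plus U f g :
  lipschitz_on U f -> lipschitz_on U g -> lipschitz_on U (fun s => f s + g s)%C.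
Proof.
  intros (A & HA & Hf) (B & HB & Hg). exists (A + B); split; [lra|]. intros s s' Hs Hs'.
  replace (f s' + g s' - (f s + g s))%C with ((f s' - f s) + (g s' - g s))%C by ring.
  eapply Rle_trans; [apply Cmod_triangle|].
  specialize (Hf s s' Hs Hs'). specialize (Hg s s' Hs Hs'). lra.
Qed.

Lemma lipschitz_on_minus U f g :
  lipschitz_on U f -> lipschitz_on U g -> lipschitz_on U (fun s => f s - g s)%C.
Proof.
  intros (A & HA & Hf) (B & HB & Hg). exists (A + B); split; [lra|]. intros s s' Hs Hs'.
  replace (f s' - g s' - (f s - g s))%C with ((f s' - f s) + - (g s' - g s))%C by ring.
  eapply Rle_trans; [apply Cmod_triangle|]. rewrite Cmod_opp.
  specialize (Hf s s' Hs Hs'). specialize (Hg s s' Hs Hs'). lra.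
Qed.

Lemma lipschitz_on_scal U c f :
  lipschitz_on U f -> lipschitz_on U (fun s => c * f s)%C.
Proof.
  intros (K & HK & H). pose proof (Cmod_ge_0 c). exists (Cmod c * K); split; [nra|].
  intros s s' Hs Hs'. replace (c * f s' - c * f s)%C with (c * (f s' - f s))%C by ring.
  rewrite Cmod_mult, Rmult_assoc. apply Rmult_le_compat_l; auto.
Qed.

Lemma lipschitz_on_comp (U V : C -> Prop) f g :
  (forall s, U s -> V (f s)) -> lipschitz_on U f -> lipschitz_on V g ->
  lipschitz_on U (fun s => g (f s)).
Proof.
  intros HUV (K & HK & Kf) (L & HL & Lg). exists (L * K); split; [nra|].
  intros s s' Hs Hs'. eapply Rle_trans; [apply Lg; auto|].
  rewrite Rmult_assoc. apply Rmult_le_compat_l; auto.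
Qed.

Definition convex_set (U : C -> Prop) : Prop :=
  forall s v t, 0 <= t <= 1 -> U s -> U (s + v)%C -> U (s + t * v)%C.

(** On a convex set derivatives along segments suffice. The Lipschitz bound is the mean value
    inequality for [f]; the quadratic bound is the same inequality for [f] minus its linear part at
    [s], whose derivative along the segment is small because [f'] is Lipschitz. *)
Lemma C11_convex (U : C -> Prop) f f' (K : R) :
  0 <= K -> convex_set U ->
  (forall s v t, U (s + RtoC t * v)%C ->
     is_derive (fun x => Re (f (s + RtoC x * v)%C)) t (Re (f' (s + RtoC t * v) * v)%C) /\
     is_derive (fun x => Im (f (s + RtoC x * v)%C)) t (Im (f' (s + RtoC t * v) * v)%C)) ->
  (forall s, U s -> Cmod (f' s) <= K) ->
  (forall s s', U s -> U s' -> Cmod (f' s' - f' s) <= K * Cmod (s' - s)) ->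
  C11 U f f'.
Proof.
  intros HK HU HD HB HL. exists (2 * K); split; [lra|].
  intros s Hs; split; [specialize (HB s Hs); lra|].
  intros s' Hs'.
  assert (Hseg : forall t, 0 <= t <= 1 -> U (s + RtoC t * (s' - s))%C).
  { intros t Ht. apply HU; auto. replace (s + (s' - s))%C with s' by ring. exact Hs'. }
  assert (E1 : (s + RtoC 1 * (s' - s))%C = s') by ring.
  assert (E0 : (s + RtoC 0 * (s' - s))%C = s) by ring.
  split.
  - pose proof (segment_mean_value (fun t => f (s + RtoC t * (s' - s))%C)
      (fun t => f' (s + RtoC t * (s' - s)) * (s' - s))%C (K * Cmod (s' - s))) as H.
    cbv beta in H. rewrite E1, E0 in H. rewrite Rmult_assoc. apply H.
    intros t Ht. destruct (HD s (s' - s)%C t (Hseg t Ht)) as [D1 D2].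
    split; [exact D1|]. split; [exact D2|].
    rewrite Cmod_mult. apply Rmult_le_compat_r; [apply Cmod_ge_0 | auto].
  - pose proof (segment_mean_value
      (fun t => f (s + RtoC t * (s' - s)) - RtoC t * (f' s * (s' - s)))%C
      (fun t => (f' (s + RtoC t * (s' - s)) - f' s) * (s' - s))%C (K * Cmod (s' - s) ^ 2)) as H.
    cbv beta in H. rewrite E1, E0 in H.
    replace (f s' - f s - f' s * (s' - s))%C with
      (f s' - RtoC 1 * (f' s * (s' - s)) - (f s - RtoC 0 * (f' s * (s' - s))))%C by ring.
    rewrite Rmult_assoc. apply H.
    intros t Ht. destruct (HD s (s' - s)%C t (Hseg t Ht)) as [D1 D2].
    set (w := (f' s * (s' - s))%C).
    replace ((f' (s + RtoC t * (s' - s)) - f' s) * (s' - s))%C with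
      (f' (s + RtoC t * (s' - s)) * (s' - s) - w)%C by (unfold w; ring).
    split; [|split].
    + apply is_derive_ext with (fun x => Re (f (s + RtoC x * (s' - s))%C) - x * Re w).
      { intros x. unfold Re; simpl; ring. }
      replace (Re (f' (s + RtoC t * (s' - s)) * (s' - s) - w)%C) with
        (minus (Re (f' (s + RtoC t * (s' - s)) * (s' - s))%C) (1 * Re w))
        by (unfold Re, minus, plus, opp; simpl; ring).
      apply @is_derive_minus; [exact D1|]. auto_derive; auto.
    + apply is_derive_ext with (fun x => Im (f (s + RtoC x * (s' - s))%C) - x * Im w).
      { intros x. unfold Im; simpl; ring. }
      replace (Im (f' (s + RtoC t * (s' - s)) * (s' - s) - w)%C) with
        (minus (Im (f' (s + RtoC t * (s' - s)) * (s' - s))%C) (1 * Im w))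
        by (unfold Im, minus, plus, opp; simpl; ring).
      apply @is_derive_minus; [exact D2|]. auto_derive; auto.
    + replace (f' (s + RtoC t * (s' - s)) * (s' - s) - w)%C with
        ((f' (s + RtoC t * (s' - s)) - f' s) * (s' - s))%C by (unfold w; ring).
      rewrite Cmod_mult.
      apply Rle_trans with (K * Cmod (RtoC t * (s' - s)) * Cmod (s' - s)).
      * apply Rmult_le_compat_r; [apply Cmod_ge_0|].
        replace (RtoC t * (s' - s))%C with (s + RtoC t * (s' - s) - s)%C at 2 by ring.
        apply HL; auto.
      * rewrite Cmod_mult, Cmod_R, Rabs_pos_eq by lra.
        pose proof (Cmod_ge_0 (s' - s)).
        assert (0 <= K * Cmod (s' - s) ^ 2) by (apply Rmult_le_pos; [lra | apply pow2_ge_0]).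
        nra.
Qed.

(** * Exponential and logarithm *)

Definition cexp (w : C) : C := (exp (Re w) * cos (Im w), exp (Re w) * sin (Im w)).

(* Principal logarithm; only meaningful for [0 < Re q]. *)
Definition clog (q : C) : C := (ln (Re q ^ 2 + Im q ^ 2) / 2, atan (Im q / Re q)).

Lemma cexp_plus (v w : C) : cexp (v + w) = (cexp v * cexp w)%C.
Proof.
  unfold cexp; apply injective_projections; unfold Re, Im; simpl.
  - rewrite exp_plus, cos_plus; ring.
  - rewrite exp_plus, sin_plus; ring.
Qed.

Lemma cexp_0 : cexp 0 = 1%C.
Proof.
  unfold cexp; apply injective_projections; unfold Re, Im; simpl;
    rewrite exp_0, ?cos_0, ?sin_0; ring.
Qed.

Lemma Cmod_cexp (w : C) : Cmod (cexp w) = exp (Re w).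
Proof.
  unfold Cmod, cexp; simpl.
  replace (_ + _) with (exp (Re w) ^ 2).
  - rewrite sqrt_pow2; [reflexivity | left; apply exp_pos].
  - pose proof (sin2_cos2 (Im w)) as E. unfold Rsqr in E.
    transitivity (exp (Re w) ^ 2 * (sin (Im w) * sin (Im w) + cos (Im w) * cos (Im w))).
    + rewrite E; ring.
    + ring.
Qed.

Lemma cexp_neq_0 (w : C) : cexp w <> 0.
Proof. apply Cmod_gt_0. rewrite Cmod_cexp. apply exp_pos. Qed.

Lemma is_derive_cexp_line (s v : C) (t : R) :
  is_derive (fun x => Re (cexp (s + RtoC x * v))) t (Re (cexp (s + RtoC t * v) * v)%C) /\
  is_derive (fun x => Im (cexp (s + RtoC x * v))) t (Im (cexp (s + RtoC t * v) * v)%C).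
Proof.
  destruct s as [s1 s2], v as [v1 v2]. unfold cexp, Re, Im; simpl.
  set (X := s1 + (t * v1 - 0 * v2)). set (Y := s2 + (t * v2 + 0 * v1)).
  split; auto_derive; auto; fold X Y;
    change (s1 + (t * v1 + - (0 * v2))) with X; ring.
Qed.

Lemma Re_plus_line (s v : C) (t : R) :
  Re (s + RtoC t * v)%C = (1 - t) * Re s + t * Re (s + v)%C.
Proof. destruct s, v; unfold Re; simpl; ring. Qed.

Lemma C11_cexp (b : R) : C11 (fun w => Re w <= b) cexp cexp.
Proof.
  assert (HU : convex_set (fun w => Re w <= b)).
  { intros s v t Ht H1 H2. rewrite Re_plus_line. nra. }
  assert (Hb : forall s, Re s <= b -> Cmod (cexp s) <= exp b).
  { intros s Hs. rewrite Cmod_cexp. destruct Hs as [Hs|Hs].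
    - left; apply exp_increasing, Hs.
    - rewrite Hs; lra. }
  pose proof (exp_pos b) as Hpos.
  (* The derivative is bounded by [exp b]; its Lipschitz constant, again from [segment_mean_value],
     is twice that. *)
  apply C11_convex with (2 * exp b); [lra | exact HU | | |].
  - intros s v t _. apply is_derive_cexp_line.
  - intros s Hs. specialize (Hb s Hs). lra.
  - intros s s' Hs Hs'.
    pose proof (segment_mean_value (fun t => cexp (s + RtoC t * (s' - s)))
      (fun t => cexp (s + RtoC t * (s' - s)) * (s' - s))%C (exp b * Cmod (s' - s))) as H.
    cbv beta in H.
    replace (s + RtoC 1 * (s' - s))%C with s' in H by ring.
    replace (s + RtoC 0 * (s' - s))%C with s in H by ring.
    rewrite Rmult_assoc. apply H. intros t Ht.
    destruct (is_derive_cexp_line s (s' - s) t) as [D1 D2].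
    split; [exact D1|]. split; [exact D2|].
    rewrite Cmod_mult. apply Rmult_le_compat_r; [apply Cmod_ge_0|].
    apply Hb, HU; auto. replace (s + (s' - s))%C with s' by ring. exact Hs'.
Qed.

Lemma Re_le_Cmod (q : C) : Re q <= Cmod q.
Proof. eapply Rle_trans; [apply Rle_abs | apply re_le_Cmod]. Qed.

Lemma Re_pos_neq_0 (q : C) : 0 < Re q -> q <> 0.
Proof. intros H E; rewrite E in H; unfold Re in H; simpl in H; lra. Qed.

Lemma Re_clog (q : C) : 0 < Re q -> Re (clog q) = ln (Cmod q).
Proof.
  intros Hq. change (Re (clog q)) with (ln (Re q ^ 2 + Im q ^ 2) / 2).
  assert (H : 0 < Cmod q) by (apply Cmod_gt_0, Re_pos_neq_0, Hq).
  rewrite <- Cmod2_alt. simpl. rewrite Rmult_1_r, ln_mult by assumption. field.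
Qed.

Lemma is_derive_clog_line (s v : C) (t : R) : 0 < Re (s + RtoC t * v)%C ->
  is_derive (fun x => Re (clog (s + RtoC x * v))) t (Re (/ (s + RtoC t * v) * v)%C) /\
  is_derive (fun x => Im (clog (s + RtoC x * v))) t (Im (/ (s + RtoC t * v) * v)%C).
Proof.
  destruct s as [s1 s2], v as [v1 v2]. unfold clog, Cinv, Re, Im; simpl. intros H.
  assert (H0 : 0 < s1 + (t * v1 - 0 * v2)) by exact H.
  assert (H2 : 0 <= (s2 + (t * v2 + 0 * v1)) ^ 2) by apply pow2_ge_0.
  simpl in H2.
  set (X := s1 + (t * v1 - 0 * v2)) in *. set (Y := s2 + (t * v2 + 0 * v1)) in *.
  assert (HX : 0 < X * X) by nra.
  split; auto_derive; fold X Y;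
    try change (s1 + (t * v1 + - (0 * v2))) with X.
  - nra.
  - field. nra.
  - lra.
  - field. nra.
Qed.

Lemma C11_clog (c : R) : 0 < c -> C11 (fun q => c <= Re q) clog (fun q => / q)%C.
Proof.
  intros Hc.
  assert (Hic : 0 < / c) by (apply Rinv_0_lt_compat, Hc).
  assert (Hlow : forall q, c <= Re q -> q <> 0 /\ Cmod (/ q) <= / c).
  { intros q Hq. assert (q <> 0) by (apply Re_pos_neq_0; lra).
    split; [assumption|]. rewrite Cmod_inv by assumption.
    apply Rinv_le_contravar; [exact Hc|]. eapply Rle_trans; [exact Hq | apply Re_le_Cmod]. }
  (* The first summand bounds [/ q], the second its Lipschitz constant. *)
  apply C11_convex with (/ c + / c * / c).
  - nra.
  - intros s v t Ht H1 H2. rewrite Re_plus_line. nra.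
  - intros s v t H. apply is_derive_clog_line. lra.
  - intros s Hs. destruct (Hlow s Hs). nra.
  - intros s s' Hs Hs'. destruct (Hlow s Hs) as [N1 B1], (Hlow s' Hs') as [N2 B2].
    replace (/ s' - / s)%C with (- (/ s' * / s * (s' - s)))%C by (field; auto).
    rewrite Cmod_opp, !Cmod_mult. apply Rmult_le_compat_r; [apply Cmod_ge_0|].
    assert (Cmod (/ s') * Cmod (/ s) <= / c * / c)
      by (apply Rmult_le_compat; auto using Cmod_ge_0). lra.
Qed.

Lemma clog_1 : clog 1 = 0.
Proof.
  unfold clog, Re, Im; apply injective_projections; simpl.
  - replace (1 * (1 * 1) + 0 * (0 * 1)) with 1 by ring. rewrite ln_1; field.
  - replace (0 / 1) with 0 by field. apply atan_0.
Qed.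

(** * Series and integrals of complex functions *)

Definition Cseries (f : nat -> C) : C :=
  (Series (fun j => Re (f j)), Series (fun j => Im (f j))).

Definition ex_Cseries (f : nat -> C) : Prop :=
  ex_series (fun j => Re (f j)) /\ ex_series (fun j => Im (f j)).

Lemma ex_Cseries_le (f : nat -> C) (b : nat -> R) :
  (forall j, Cmod (f j) <= b j) -> ex_series b -> ex_Cseries f.
Proof.
  intros H Hb.
  split; apply (ex_series_le (V := R_CompleteNormedModule)) with b; auto; intros j; eapply Rle_trans; [|apply H| |apply H].
  - apply re_le_Cmod.
  - apply im_le_Cmod.
Qed.

Lemma Rabs_Series_le (u b : nat -> R) :
  (forall j, Rabs (u j) <= b j) -> ex_series b -> Rabs (Series u) <= Series b.
Proof.
  intros H Hb. eapply Rle_trans; [apply Series_Rabs|].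
  - apply (ex_series_le (V := R_CompleteNormedModule)) with b; auto.
    intros j; unfold norm; simpl; unfold abs; simpl. rewrite Rabs_Rabsolu; auto.
  - apply Series_le; auto. intros j; split; [apply Rabs_pos | apply H].
Qed.

Lemma Cmod_Cseries_le (f : nat -> C) (b : nat -> R) :
  (forall j, Cmod (f j) <= b j) -> ex_series b -> Cmod (Cseries f) <= 2 * Series b.
Proof.
  intros H Hb. apply Cmod_le_parts; unfold Cseries, Re at 1, Im at 1; simpl;
    apply Rabs_Series_le; auto; intros j; eapply Rle_trans; [|apply H| |apply H].
  - apply re_le_Cmod.
  - apply im_le_Cmod.
Qed.

Lemma Cseries_minus (f g : nat -> C) : ex_Cseries f -> ex_Cseries g ->
  Cseries (fun j => f j - g j)%C = (Cseries f - Cseries g)%C.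
Proof.
  intros [F1 F2] [G1 G2]. apply injective_projections.
  - exact (Series_minus _ _ F1 G1).
  - exact (Series_minus _ _ F2 G2).
Qed.

Lemma Cseries_scal_r (f : nat -> C) (c : C) : ex_Cseries f ->
  Cseries (fun j => f j * c)%C = (Cseries f * c)%C.
Proof.
  intros [F1 F2].
  assert (S : forall u (x : R), ex_series u -> ex_series (fun j => u j * x))
    by (intros u x Hu; apply ex_series_scal_r, Hu).
  apply injective_projections.
  - change (Series (fun j => Re (f j) * fst c - Im (f j) * snd c) =
      Series (fun j => Re (f j)) * fst c - Series (fun j => Im (f j)) * snd c).
    rewrite <- !Series_scal_r, <- Series_minus by auto. reflexivity.
  - change (Series (fun j => Re (f j) * snd c + Im (f j) * fst c) =
      Series (fun j => Re (f j)) * snd c + Series (fun j => Im (f j)) * fst c).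
    rewrite <- !Series_scal_r, <- Series_plus by auto. reflexivity.
Qed.

(** Termwise differentiation: the remainder of the sum is the sum of the remainders, and the
    constants [b j] are summable independently of the points. *)
Lemma C11_Cseries (U : C -> Prop) (f f' : nat -> C -> C) (b : nat -> R) :
  ex_series b ->
  (forall s, U s -> ex_Cseries (fun j => f j s)) ->
  (forall j s, U s -> Cmod (f' j s) <= b j /\
    forall s', U s' ->
      Cmod (f j s' - f j s) <= b j * Cmod (s' - s) /\
      Cmod (f j s' - f j s - f' j s * (s' - s)) <= b j * Cmod (s' - s) ^ 2) ->
  C11 U (fun s => Cseries (fun j => f j s)) (fun s => Cseries (fun j => f' j s)).
Proof.
  intros Hb Hf H.
  assert (S : forall x, ex_series (fun j => b j * x))
    by (intros x; apply ex_series_scal_r, Hb).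
  (* When [U] is empty nothing forces [b] to be nonnegative, hence the absolute value. *)
  exists (2 * Rabs (Series b)); split; [pose proof (Rabs_pos (Series b)); lra|].
  pose proof (Rle_abs (Series b)) as Habs.
  intros s Hs.
  assert (Hf' : ex_Cseries (fun j => f' j s)).
  { apply ex_Cseries_le with b; auto. intros j; apply H, Hs. }
  assert (Hf's : forall d, ex_Cseries (fun j => f' j s * d)%C).
  { intros d. apply ex_Cseries_le with (fun j => b j * Cmod d); auto.
    intros j; rewrite Cmod_mult; apply Rmult_le_compat_r; [apply Cmod_ge_0 | apply H, Hs]. }
  split.
  - eapply Rle_trans; [apply (Cmod_Cseries_le _ b); auto; intros j; apply H, Hs | lra].
  - intros s' Hs'.
    assert (Hd : ex_Cseries (fun j => f j s' - f j s)%C).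
    { apply ex_Cseries_le with (fun j => b j * Cmod (s' - s)); auto.
      intros j; apply H; auto. }
    split.
    + rewrite <- Cseries_minus by auto.
      eapply Rle_trans.
      * apply (Cmod_Cseries_le _ (fun j => b j * Cmod (s' - s))); auto. intros j; apply H; auto.
      * rewrite Series_scal_r. pose proof (Cmod_ge_0 (s' - s)). nra.
    + rewrite <- Cseries_minus, <- Cseries_scal_r, <- Cseries_minus by auto.
      eapply Rle_trans.
      * apply (Cmod_Cseries_le _ (fun j => b j * Cmod (s' - s) ^ 2)); auto. intros j; apply H; auto.
      * rewrite Series_scal_r. pose proof (pow2_ge_0 (Cmod (s' - s))). nra.
Qed.

(** * Integrals over a full turn, with the angle as parameter *)

Definition real_axis (s : C) : Prop := Im s = 0.

Definition cint (f : C -> C) : C :=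
  (RInt (fun t => Re (f (RtoC t))) 0 (2 * PI), RInt (fun t => Im (f (RtoC t))) 0 (2 * PI)).

Lemma lipschitz_continuous (u : R -> R) (K : R) :
  (forall x y, Rabs (u y - u x) <= K * Rabs (y - x)) -> forall x, continuous u x.
Proof.
  intros H x. apply continuity_pt_filterlim. intros eps Heps.
  exists (eps / (Rabs K + 1)). pose proof (Rabs_pos K). pose proof (Rle_abs K).
  split; [apply Rdiv_lt_0_compat; lra|].
  intros y [_ Hy]. simpl in *. unfold R_dist in *.
  eapply Rle_lt_trans; [apply H|].
  apply Rle_lt_trans with ((Rabs K + 1) * Rabs (y - x)).
  - apply Rmult_le_compat_r; [apply Rabs_pos | lra].
  - apply Rmult_lt_reg_r with (/ (Rabs K + 1)); [apply Rinv_0_lt_compat; lra|].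
    replace ((Rabs K + 1) * Rabs (y - x) * / (Rabs K + 1)) with (Rabs (y - x)) by (field; lra).
    exact Hy.
Qed.

Lemma lipschitz_on_real_axis f : lipschitz_on real_axis f ->
  exists K, forall x y : R,
    Rabs (Re (f (RtoC y)) - Re (f (RtoC x))) <= K * Rabs (y - x) /\
    Rabs (Im (f (RtoC y)) - Im (f (RtoC x))) <= K * Rabs (y - x).
Proof.
  intros (K & HK & H). exists K. intros x y.
  specialize (H (RtoC x) (RtoC y) eq_refl eq_refl).
  rewrite <- RtoC_minus, Cmod_R in H.
  split; (eapply Rle_trans; [|apply H]).
  - apply (re_le_Cmod (f (RtoC y) - f (RtoC x))).
  - apply (im_le_Cmod (f (RtoC y) - f (RtoC x))).
Qed.

Lemma lipschitz_on_continuous f : lipschitz_on real_axis f ->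
  (forall x : R, continuous (fun t => Re (f (RtoC t))) x) /\
  (forall x : R, continuous (fun t => Im (f (RtoC t))) x).
Proof.
  intros H. destruct (lipschitz_on_real_axis f H) as [K HK].
  split; apply lipschitz_continuous with K; intros x y; apply HK.
Qed.

Lemma lipschitz_on_ex_RInt f : lipschitz_on real_axis f ->
  ex_RInt (fun t => Re (f (RtoC t))) 0 (2 * PI) /\
  ex_RInt (fun t => Im (f (RtoC t))) 0 (2 * PI).
Proof.
  intros H. destruct (lipschitz_on_continuous f H).
  split; apply (ex_RInt_continuous (V := R_CompleteNormedModule)); auto.
Qed.

Lemma cint_ext f g : (forall t, real_axis t -> f t = g t) -> cint f = cint g.
Proof.
  intros H. unfold cint. f_equal; apply RInt_ext; intros x _; rewrite H; reflexivity.
Qed.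

Lemma cint_minus f g : lipschitz_on real_axis f -> lipschitz_on real_axis g ->
  cint (fun t => f t - g t)%C = (cint f - cint g)%C.
Proof.
  intros Hf Hg.
  destruct (lipschitz_on_ex_RInt f Hf) as [F1 F2], (lipschitz_on_ex_RInt g Hg) as [G1 G2].
  apply injective_projections; unfold cint; simpl.
  - exact (RInt_minus (V := R_CompleteNormedModule) _ _ _ _ F1 G1).
  - exact (RInt_minus (V := R_CompleteNormedModule) _ _ _ _ F2 G2).
Qed.

Lemma cint_plus f g : lipschitz_on real_axis f -> lipschitz_on real_axis g ->
  cint (fun t => f t + g t)%C = (cint f + cint g)%C.
Proof.
  intros Hf Hg.
  destruct (lipschitz_on_ex_RInt f Hf) as [F1 F2], (lipschitz_on_ex_RInt g Hg) as [G1 G2].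
  apply injective_projections; unfold cint; simpl.
  - exact (RInt_plus (V := R_CompleteNormedModule) _ _ _ _ F1 G1).
  - exact (RInt_plus (V := R_CompleteNormedModule) _ _ _ _ F2 G2).
Qed.

Lemma cint_scal c f : lipschitz_on real_axis f ->
  cint (fun t => c * f t)%C = (c * cint f)%C.
Proof.
  intros Hf. destruct (lipschitz_on_ex_RInt f Hf) as [F1 F2].
  assert (S : forall u (x : R), ex_RInt u 0 (2 * PI) ->
    ex_RInt (fun t => x * u t) 0 (2 * PI) /\
    RInt (fun t => x * u t) 0 (2 * PI) = x * RInt u 0 (2 * PI)).
  { intros u x Hu. split.
    - exact (ex_RInt_scal (V := R_NormedModule) u 0 (2 * PI) x Hu).
    - exact (RInt_scal (V := R_CompleteNormedModule) u 0 (2 * PI) x Hu). }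
  apply injective_projections; unfold cint; simpl.
  - destruct (S _ (fst c) F1) as [A1 A2], (S _ (snd c) F2) as [B1 B2].
    rewrite <- A2, <- B2. exact (RInt_minus (V := R_CompleteNormedModule) _ _ _ _ A1 B1).
  - destruct (S _ (fst c) F2) as [A1 A2], (S _ (snd c) F1) as [B1 B2].
    rewrite <- A2, <- B2. exact (RInt_plus (V := R_CompleteNormedModule) _ _ _ _ A1 B1).
Qed.

Lemma cint_const c : cint (fun _ => c) = (2 * PI * c)%C.
Proof.
  unfold cint. rewrite !RInt_const. unfold scal; simpl; unfold mult; simpl.
  apply injective_projections; unfold Re, Im; simpl; ring.
Qed.

Lemma Cmod_cint_le f (B : R) : lipschitz_on real_axis f ->
  (forall t, real_axis t -> Cmod (f t) <= B) -> Cmod (cint f) <= 2 * (2 * PI * B).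
Proof.
  intros Hf HB. destruct (lipschitz_on_ex_RInt f Hf) as [F1 F2].
  pose proof PI_RGT_0.
  assert (A : forall u, ex_RInt u 0 (2 * PI) -> (forall t, Rabs (u t) <= B) ->
    Rabs (RInt u 0 (2 * PI)) <= 2 * PI * B).
  { intros u Hu Hb. eapply Rle_trans.
    - apply abs_RInt_le_const with (M := B); auto; lra.
    - right; ring. }
  apply Cmod_le_parts; unfold cint, Re at 1, Im at 1; simpl; apply A; auto;
    intros t; (eapply Rle_trans; [|apply (HB (RtoC t)); reflexivity]).
  - apply re_le_Cmod.
  - apply im_le_Cmod.
Qed.

Lemma quadratic_is_derive (u : R -> R) (x l K : R) :
  (forall y, Rabs (u y - u x - l * (y - x)) <= K * Rabs (y - x) ^ 2) -> is_derive u x l.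
Proof.
  intros H. apply is_derive_Reals. intros eps Heps.
  pose proof (Rabs_pos K). pose proof (Rle_abs K).
  assert (Hd : 0 < eps / (Rabs K + 1)) by (apply Rdiv_lt_0_compat; lra).
  exists (mkposreal _ Hd). intros h Hh Hlt. simpl in Hlt.
  specialize (H (x + h)). replace (x + h - x) with h in H by ring.
  assert (Hp : 0 < Rabs h) by (apply Rabs_pos_lt, Hh).
  replace ((u (x + h) - u x) / h - l) with ((u (x + h) - u x - l * h) / h) by (field; exact Hh).
  unfold Rdiv. rewrite Rabs_mult, Rabs_inv.
  apply Rle_lt_trans with (Rabs K * Rabs h).
  - apply Rmult_le_reg_r with (Rabs h); [exact Hp|].
    rewrite Rmult_assoc, Rinv_l, Rmult_1_r by lra. nra.
  - apply Rmult_lt_compat_r with (r := Rabs K + 1) in Hlt; [|lra].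
    unfold Rdiv in Hlt. rewrite Rmult_assoc, Rinv_l in Hlt by lra. nra.
Qed.

(** The fundamental theorem of calculus; the continuity it asks of [f'] comes from the Lipschitz
    bound implied by [C11]. *)
Lemma cint_derivative f f' : C11 real_axis f f' ->
  cint f' = (f (RtoC (2 * PI)) - f (RtoC 0))%C.
Proof.
  intros H. destruct (lipschitz_on_continuous f' (C11_lipschitz_derivative _ _ _ H)) as [C1 C2].
  destruct H as (K & HK & H).
  assert (Q : forall x y : R,
    Rabs (Re (f (RtoC y)) - Re (f (RtoC x)) - Re (f' (RtoC x)) * (y - x)) <= K * Rabs (y - x) ^ 2 /\
    Rabs (Im (f (RtoC y)) - Im (f (RtoC x)) - Im (f' (RtoC x)) * (y - x)) <= K * Rabs (y - x) ^ 2).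
  { intros x y. destruct (H (RtoC x) eq_refl) as [_ H1].
    destruct (H1 (RtoC y) eq_refl) as [_ H2].
    set (w := (f (RtoC y) - f (RtoC x) - f' (RtoC x) * (RtoC y - RtoC x))%C) in H2.
    rewrite <- RtoC_minus, Cmod_R in H2.
    split; (eapply Rle_trans; [|apply H2]).
    - eapply Rle_trans; [|apply re_le_Cmod]. right; f_equal. unfold w, Re; simpl; ring.
    - eapply Rle_trans; [|apply im_le_Cmod]. right; f_equal. unfold w, Im; simpl; ring. }
  apply injective_projections; unfold cint; simpl.
  - apply is_RInt_unique.
    apply (is_RInt_derive (V := R_CompleteNormedModule) (fun t => Re (f (RtoC t)))); auto.
    intros x _. apply quadratic_is_derive with K. intros y; apply Q.
  - apply is_RInt_unique.
    apply (is_RInt_derive (V := R_CompleteNormedModule) (fun t => Im (f (RtoC t)))); auto.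
    intros x _. apply quadratic_is_derive with K. intros y; apply Q.
Qed.

Lemma lipschitz_on_affine (T V : C -> Prop) (c l k : C -> C) (s : C) :
  lipschitz_on T c -> lipschitz_on T l -> lipschitz_on V k ->
  (forall t, T t -> V (c t * s + l t)%C) ->
  lipschitz_on T (fun t => k (c t * s + l t))%C.
Proof.
  intros (A & HA & Hc) (B & HB & Hl) Hk HV.
  apply (lipschitz_on_comp T V (fun t => c t * s + l t)%C k); auto.
  pose proof (Cmod_ge_0 s).
  exists (A * Cmod s + B); split; [nra|]. intros t t' Ht Ht'.
  replace (c t' * s + l t' - (c t * s + l t))%C with ((c t' - c t) * s + (l t' - l t))%C by ring.
  eapply Rle_trans; [apply Cmod_triangle|]. rewrite Cmod_mult.
  specialize (Hc t t' Ht Ht'). specialize (Hl t t' Ht Ht'). nra.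
Qed.

(** Differentiation under the integral sign, by integrating the quadratic bounds. The affine
    argument [c t * s + l t] serves two purposes: with [l = 0] it varies the radius of a circle,
    with [c = 1] it translates a fixed curve. *)
Lemma C11_cint (U V : C -> Prop) (k k' c l e : C -> C) :
  C11 V k k' -> bounded_on V k ->
  bounded_on real_axis c -> lipschitz_on real_axis c -> lipschitz_on real_axis l ->
  bounded_on real_axis e -> lipschitz_on real_axis e ->
  (forall s t, U s -> real_axis t -> V (c t * s + l t)%C) ->
  C11 U (fun s => cint (fun t => k (c t * s + l t)%C * e t)%C)
        (fun s => cint (fun t => k' (c t * s + l t)%C * (c t * e t))%C).
Proof.
  intros Hk Bk Bc Lc Ll Be Le HV.
  pose proof (C11_lipschitz_derivative _ _ _ Hk) as Lk'.
  pose proof (C11_lipschitz _ _ _ Hk) as Lk.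
  pose proof (C11_bounded_derivative _ _ _ Hk) as Bk'.
  assert (L1 : forall s, U s -> lipschitz_on real_axis (fun t => k (c t * s + l t)%C * e t)%C).
  { intros s Hs. apply lipschitz_on_mult; auto.
    - destruct Bk as (B & HB & Hb). exists B; split; auto.
    - apply lipschitz_on_affine with V; auto. }
  assert (L2 : forall s, U s -> lipschitz_on real_axis (fun t => k' (c t * s + l t)%C * (c t * e t))%C).
  { intros s Hs. apply lipschitz_on_mult.
    - destruct Bk' as (B & HB & Hb). exists B; split; auto.
    - apply bounded_on_mult; auto.
    - apply lipschitz_on_affine with V; auto.
    - apply lipschitz_on_mult; auto. }
  assert (L3 : forall s (d : C), U s ->
    lipschitz_on real_axis (fun t => d * (k' (c t * s + l t)%C * (c t * e t)))%C)
    by (intros; apply lipschitz_on_scal; auto).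
  pose proof (lipschitz_on_minus real_axis) as L4.
  destruct Hk as (K & HK & Hk), Bc as (A & HA & Bc), Be as (B & HB & Be).
  pose proof PI_RGT_0 as Hpi.
  assert (0 <= K * (A * B)) by (apply Rmult_le_pos; nra).
  assert (0 <= K * A ^ 2 * B) by (apply Rmult_le_pos; nra).
  exists (2 * (2 * PI * (K * (A * B) + K * A ^ 2 * B))). split.
  { apply Rmult_le_pos; [lra|]. apply Rmult_le_pos; lra. }
  intros s Hs. split.
  - apply Cmod_cint_le; auto. intros t Ht. rewrite !Cmod_mult.
    destruct (Hk _ (HV s t Hs Ht)) as [H1 _].
    assert (Cmod (c t) * Cmod (e t) <= A * B) by (apply Rmult_le_compat; auto using Cmod_ge_0).
    assert (Cmod (k' (c t * s + l t)%C) * (Cmod (c t) * Cmod (e t)) <= K * (A * B)).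
    { apply Rmult_le_compat; auto using Cmod_ge_0. apply Rmult_le_pos; apply Cmod_ge_0. }
    lra.
  - intros s' Hs'. pose proof (Cmod_ge_0 (s' - s)) as Hd.
    assert (P : forall t, real_axis t ->
      Cmod (k (c t * s' + l t)%C - k (c t * s + l t)%C) <= K * (A * Cmod (s' - s)) /\
      Cmod (k (c t * s' + l t)%C - k (c t * s + l t)%C - k' (c t * s + l t)%C * (c t * (s' - s)))
        <= K * (A * Cmod (s' - s)) ^ 2).
    { intros t Ht. destruct (Hk _ (HV s t Hs Ht)) as [_ H1].
      destruct (H1 _ (HV s' t Hs' Ht)) as [H2 H3].
      replace (c t * s' + l t - (c t * s + l t)%C)%C with (c t * (s' - s))%C in H2, H3 by ring.
      assert (Hcd : Cmod (c t * (s' - s)) <= A * Cmod (s' - s)).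
      { rewrite Cmod_mult. apply Rmult_le_compat_r; auto. }
      split.
      - eapply Rle_trans; [apply H2|]. apply Rmult_le_compat_l; auto.
      - eapply Rle_trans; [apply H3|]. apply Rmult_le_compat_l; auto.
        apply pow_incr; split; [apply Cmod_ge_0 | auto]. }
    split.
    + rewrite <- cint_minus by auto. eapply Rle_trans.
      * apply Cmod_cint_le with (B := K * (A * B) * Cmod (s' - s)); auto. intros t Ht.
        replace (k (c t * s' + l t)%C * e t - k (c t * s + l t)%C * e t)%C with
          ((k (c t * s' + l t)%C - k (c t * s + l t)%C) * e t)%C by ring.
        rewrite Cmod_mult. destruct (P t Ht) as [P1 _].
        apply Rle_trans with (K * (A * Cmod (s' - s)) * B); [|right; ring].
        apply Rmult_le_compat; auto using Cmod_ge_0.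
      * rewrite !Rmult_assoc. apply Rmult_le_compat_l; [lra|]. apply Rmult_le_compat_l; [lra|].
        apply Rmult_le_compat_l; [lra|]. nra.
    + rewrite Cmult_comm, <- cint_scal, <- !cint_minus by auto. eapply Rle_trans.
      * apply Cmod_cint_le with (B := K * A ^ 2 * B * Cmod (s' - s) ^ 2); auto. intros t Ht.
        replace (k (c t * s' + l t)%C * e t - k (c t * s + l t)%C * e t
                 - (s' - s) * (k' (c t * s + l t)%C * (c t * e t)))%C with
          ((k (c t * s' + l t)%C - k (c t * s + l t)%C - k' (c t * s + l t)%C * (c t * (s' - s))) * e t)%C by ring.
        rewrite Cmod_mult. destruct (P t Ht) as [_ P2].
        apply Rle_trans with (K * (A * Cmod (s' - s)) ^ 2 * B); [|right; ring].
        apply Rmult_le_compat; auto using Cmod_ge_0.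
      * rewrite !Rmult_assoc. apply Rmult_le_compat_l; [lra|]. apply Rmult_le_compat_l; [lra|].
        apply Rmult_le_compat_l; [lra|]. pose proof (pow2_ge_0 (Cmod (s' - s))). nra.
Qed.

(* Telescope over [n] equal steps and let [n] grow. *)
Lemma quadratic_increment_constant (f : R -> C) (r K : R) :
  0 <= r -> 0 <= K ->
  (forall x y, 0 <= x < y -> y <= r -> Cmod (f y - f x) <= K * (y - x) ^ 2) ->
  f r = f 0.
Proof.
  intros Hr HK H.
  destruct Hr as [Hr|Hr]; [|rewrite <- Hr; reflexivity].
  assert (Hn : forall n, (0 < n)%nat -> Cmod (f r - f 0) <= K * r ^ 2 * / INR n).
  { intros n Hn. apply lt_0_INR in Hn as Hn'.
    assert (Hrn : 0 < r / INR n) by (apply Rdiv_lt_0_compat; auto).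
    assert (G : forall k, (k <= n)%nat -> Cmod (f (INR k * (r / INR n)) - f 0) <= INR k * (K * (r / INR n) ^ 2)).
    { induction k as [|k IH]; intros Hk.
      - simpl INR. rewrite !Rmult_0_l. replace (f 0 - f 0)%C with (RtoC 0) by ring. rewrite Cmod_0; lra.
      - rewrite S_INR.
        replace (f ((INR k + 1) * (r / INR n))%R - f 0)%C with
          ((f ((INR k + 1) * (r / INR n))%R - f (INR k * (r / INR n))%R)
           + (f (INR k * (r / INR n))%R - f 0))%C by ring.
        eapply Rle_trans; [apply Cmod_triangle|].
        replace ((INR k + 1) * (K * (r / INR n) ^ 2)) with
          (K * (r / INR n) ^ 2 + INR k * (K * (r / INR n) ^ 2)) by ring.
        apply Rplus_le_compat; [|apply IH; lia].
        eapply Rle_trans; [apply H|].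
        + pose proof (pos_INR k). nra.
        + assert (INR k + 1 <= INR n) by (rewrite <- S_INR; apply le_INR, Hk).
          apply Rmult_le_reg_r with (INR n / r); [apply Rdiv_lt_0_compat; auto|].
          replace ((INR k + 1) * (r / INR n) * (INR n / r)) with (INR k + 1) by (field; lra).
          replace (r * (INR n / r)) with (INR n) by (field; lra). lra.
        + right; ring. }
    specialize (G n (le_n n)).
    replace (INR n * (r / INR n)) with r in G by (field; lra).
    replace (INR n * (K * (r / INR n) ^ 2)) with (K * r ^ 2 * / INR n) in G by (field; lra).
    exact G. }
  assert (Z : Cmod (f r - f 0) = 0).
  { destruct (Cmod_ge_0 (f r - f 0)) as [P|P]; [exfalso|auto].
    assert (HKr : 0 <= K * r ^ 2) by (apply Rmult_le_pos; [lra|apply pow2_ge_0]).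
    destruct (archimed_cor1 (Cmod (f r - f 0) / (K * r ^ 2 + 1))) as [n [N1 N2]].
    { apply Rdiv_lt_0_compat; lra. }
    specialize (Hn n N2).
    apply Rmult_lt_compat_r with (r := K * r ^ 2 + 1) in N1; [|lra].
    unfold Rdiv in N1. rewrite Rmult_assoc, Rinv_l in N1 by lra.
    assert (0 < / INR n) by (apply Rinv_0_lt_compat, lt_0_INR, N2). nra. }
  apply Cmod_eq_0 in Z.
  replace (f r) with (f r - f 0 + f 0)%C by ring. rewrite Z; ring.
Qed.

Lemma Re_Ci_mult (c : R) (t : C) : real_axis t -> Re (RtoC c * Ci * t)%C = 0.
Proof. destruct t as [x y]; unfold real_axis, Re, Im; simpl; intros ->; ring. Qed.

Lemma C11_unit_circle (c : R) :
  C11 real_axis (fun t => cexp (RtoC c * Ci * t)) (fun t => cexp (RtoC c * Ci * t) * (RtoC c * Ci))%C.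
Proof.
  apply (C11_comp real_axis (fun w => Re w <= 0) (fun t => RtoC c * Ci * t)%C (fun _ => RtoC c * Ci)%C cexp cexp).
  - intros t Ht. rewrite Re_Ci_mult by assumption. lra.
  - apply C11_ext with (f := fun t => (RtoC c * Ci * t + 0)%C) (f' := fun _ => (RtoC c * Ci)%C);
      [intros; ring | reflexivity | apply C11_affine].
  - apply C11_cexp.
Qed.

Lemma Cmod_unit_circle (c : R) (t : C) : real_axis t -> Cmod (cexp (RtoC c * Ci * t)) = 1.
Proof. intros Ht. rewrite Cmod_cexp, Re_Ci_mult by assumption. apply exp_0. Qed.

Lemma unit_circle_end (n : nat) :
  cexp (RtoC (INR n) * Ci * RtoC (2 * PI)) = 1%C /\
  cexp (RtoC (- INR n) * Ci * RtoC (2 * PI)) = 1%C.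
Proof.
  pose proof (cos_period 0 n) as Hc. pose proof (sin_period 0 n) as Hs.
  rewrite Rplus_0_l in Hc, Hs. rewrite cos_0 in Hc. rewrite sin_0 in Hs.
  unfold cexp.
  replace (Re (RtoC (INR n) * Ci * RtoC (2 * PI))%C) with 0 by (unfold Re; simpl; ring).
  replace (Im (RtoC (INR n) * Ci * RtoC (2 * PI))%C) with (2 * INR n * PI) by (unfold Im; simpl; ring).
  replace (Re (RtoC (- INR n) * Ci * RtoC (2 * PI))%C) with 0 by (unfold Re; simpl; ring).
  replace (Im (RtoC (- INR n) * Ci * RtoC (2 * PI))%C) with (- (2 * INR n * PI)) by (unfold Im; simpl; ring).
  rewrite cos_neg, sin_neg, Hc, Hs, exp_0.
  split; apply injective_projections; simpl; ring.
Qed.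

(** * Cauchy's formula in the logarithmic coordinate *)

Lemma bounded_on_comp (U V : C -> Prop) f g :
  (forall s, U s -> V (f s)) -> bounded_on V g -> bounded_on U (fun s => g (f s)).
Proof. intros H (K & HK & B). exists K; split; auto. Qed.

Lemma bounded_on_const U c : bounded_on U (fun _ => c).
Proof. exists (Cmod c); split; [apply Cmod_ge_0 | intros; lra]. Qed.

Lemma lipschitz_on_const U c : lipschitz_on U (fun _ => c).
Proof.
  exists 0; split; [lra|]. intros s s' _ _.
  replace (c - c)%C with (RtoC 0) by ring. rewrite Cmod_0; lra.
Qed.

Lemma bounded_on_circle (c : R) : bounded_on real_axis (fun t => cexp (RtoC c * Ci * t)).
Proof.
  exists 1; split; [lra|]. intros t Ht. rewrite Cmod_unit_circle by assumption. lra.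
Qed.

Lemma C11_scal_l U f f' c : C11 U f f' -> C11 U (fun s => c * f s)%C (fun s => c * f' s)%C.
Proof.
  intros H. apply (C11_comp U (fun _ => True) f f' (fun s => c * s)%C (fun _ => c)); auto.
  apply C11_ext with (f := fun s => (c * s + 0)%C) (f' := fun _ => c);
    [intros; ring | reflexivity | apply C11_affine].
Qed.

(** Let [phi s] be the integral of [k (s e^(it))] over a turn, for real [s] between 0 and [r]. Then
    [i s phi' s] is the integral of the [t]-derivative of a periodic function, so [phi'] vanishes
    for [s <> 0] and [phi] is constant; at [s = 0] the integrand is the constant [k 0]. *)
Lemma mean_value_circle (k k' : C -> C) (r : R) : 0 <= r ->
  C11 (fun u => Cmod u <= r) k k' -> bounded_on (fun u => Cmod u <= r) k ->
  cint (fun t => k (RtoC r * cexp (RtoC 1 * Ci * t)))%C = (2 * PI * k 0)%C.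
Proof.
  intros Hr Hk Bk.
  set (c := fun t => cexp (RtoC 1 * Ci * t)).
  set (U := fun s : C => Im s = 0 /\ 0 <= Re s <= r).
  assert (HU : forall s, U s -> s = RtoC (Re s)).
  { intros s [H _]. apply injective_projections; [reflexivity | exact H]. }
  assert (Hc : forall s t, U s -> real_axis t -> Cmod (c t * s) <= r).
  { intros s t Hs Ht. unfold c. rewrite Cmod_mult, Cmod_unit_circle by assumption.
    rewrite (HU s Hs), Cmod_R. destruct Hs as [_ Hs]. rewrite Rabs_pos_eq; lra. }
  set (phi := fun s => cint (fun t => k (c t * s + 0) * 1)%C).
  set (phi' := fun s => cint (fun t => k' (c t * s + 0) * (c t * 1))%C).
  assert (Hphi : C11 U phi phi').
  { apply (C11_cint U (fun u => Cmod u <= r) k k' c (fun _ => 0%C) (fun _ => 1%C)); auto.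
    - apply bounded_on_circle.
    - apply (C11_lipschitz _ _ _ (C11_unit_circle 1)).
    - apply lipschitz_on_const.
    - apply bounded_on_const.
    - apply lipschitz_on_const.
    - intros s t Hs Ht. replace (c t * s + 0)%C with (c t * s)%C by ring. auto. }
  assert (Z : forall s, U s -> s <> 0%C -> phi' s = 0%C).
  { intros s Hs Hs0.
    assert (Hf : C11 real_axis (fun t => k (s * c t)%C)
              (fun t => k' (s * c t) * (s * (c t * (RtoC 1 * Ci))))%C).
    { apply (C11_comp real_axis (fun u => Cmod u <= r) (fun t => s * c t)%C
        (fun t => s * (c t * (RtoC 1 * Ci)))%C); auto.
      - intros t Ht. rewrite Cmult_comm. auto.
      - apply C11_scal_l, C11_unit_circle. }
    pose proof (cint_derivative _ _ Hf) as E. cbv beta in E.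
    replace (c (RtoC (2 * PI))) with (c (RtoC 0)) in E.
    2:{ unfold c. rewrite (proj1 (unit_circle_end 1) : cexp (RtoC 1 * Ci * RtoC (2 * PI)) = 1%C).
        replace (RtoC 1 * Ci * RtoC 0)%C with (RtoC 0) by ring. apply cexp_0. }
    replace (k (s * c (RtoC 0)) - k (s * c (RtoC 0)))%C with (RtoC 0) in E by ring.
    assert (E2 : cint (fun t => k' (s * c t) * (s * (c t * (RtoC 1 * Ci))))%C = (s * Ci * phi' s)%C).
    { unfold phi'. rewrite <- cint_scal.
      - apply cint_ext. intros t Ht.
        replace (c t * s + 0)%C with (s * c t)%C by ring. ring.
      - apply lipschitz_on_mult.
        + apply (bounded_on_comp real_axis (fun u => Cmod u <= r) (fun t => c t * s + 0)%C k').
          * intros t Ht. replace (c t * s + 0)%C with (c t * s)%C by ring. auto.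
          * apply (C11_bounded_derivative _ _ _ Hk).
        + apply bounded_on_mult; [apply bounded_on_circle | apply bounded_on_const].
        + apply lipschitz_on_affine with (fun u => Cmod u <= r).
          * apply (C11_lipschitz _ _ _ (C11_unit_circle 1)).
          * apply lipschitz_on_const.
          * apply (C11_lipschitz_derivative _ _ _ Hk).
          * intros t Ht. replace (c t * s + 0)%C with (c t * s)%C by ring. auto.
        + apply lipschitz_on_mult.
          * apply bounded_on_circle.
          * apply bounded_on_const.
          * apply (C11_lipschitz _ _ _ (C11_unit_circle 1)).
          * apply lipschitz_on_const. }
    rewrite E in E2.
    assert (Hi : (s * Ci)%C <> 0%C).
    { apply Cmult_neq_0; [exact Hs0|]. intros A. apply (f_equal snd) in A. simpl in A. lra. }
    replace (phi' s) with ((s * Ci * phi' s) / (s * Ci))%C by (field; split;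
      [ intros A; apply (f_equal snd) in A; simpl in A; lra | exact Hs0 ]).
    rewrite <- E2. field. split;
      [ intros A; apply (f_equal snd) in A; simpl in A; lra | exact Hs0 ]. }
  assert (E : phi (RtoC r) = phi (RtoC 0)).
  { destruct Hphi as (K & HK & H).
    apply (quadratic_increment_constant (fun x => phi (RtoC x)) r K); auto.
    intros x y [Hx Hxy] Hy.
    assert (Ux : U (RtoC x)) by (split; simpl; [reflexivity | unfold Re; simpl; lra]).
    assert (Uy : U (RtoC y)) by (split; simpl; [reflexivity | unfold Re; simpl; lra]).
    (* The expansion is taken at the larger point [y]: [x] may be 0, where the vanishing of [phi']
       has not been shown. *)
    destruct (H _ Uy) as [_ H1]. destruct (H1 _ Ux) as [_ H2].
    rewrite Z in H2; auto.
    2:{ intros A. apply (f_equal fst) in A. simpl in A. lra. }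
    replace (phi (RtoC x) - phi (RtoC y) - 0 * (RtoC x - RtoC y))%C with
      (- (phi (RtoC y) - phi (RtoC x)))%C in H2 by ring.
    rewrite Cmod_opp, <- RtoC_minus, Cmod_R, <- Rsqr_pow2, <- Rsqr_abs, Rsqr_pow2 in H2.
    replace ((y - x) ^ 2) with ((x - y) ^ 2) by ring. exact H2. }
  transitivity (phi (RtoC r)).
  { apply cint_ext. intros t _. fold (c t).
    replace (c t * RtoC r + 0)%C with (RtoC r * c t)%C by ring. ring. }
  rewrite E. unfold phi.
  rewrite <- cint_const. apply cint_ext. intros t _.
  replace (c t * RtoC 0 + 0)%C with (RtoC 0) by ring. ring.
Qed.

Lemma C11_clog_1_plus :
  C11 (fun u => Cmod u <= / 2) (fun u => clog (1 + u)) (fun u => / (1 + u))%C.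
Proof.
  apply C11_ext with (f := fun u => clog (1 * u + 1)) (f' := fun u => (/ (1 * u + 1) * 1)%C).
  - intros u _. f_equal. ring.
  - intros u _. replace (1 * u + 1)%C with (1 + u)%C by ring. ring.
  - apply (C11_comp _ (fun q => / 2 <= Re q) (fun u => 1 * u + 1)%C (fun _ => 1%C)).
    + intros u Hu. pose proof (re_le_Cmod u) as H. apply Rabs_le_between in H.
      replace (Re (1 * u + 1)%C) with (Re u + 1) by (unfold Re; simpl; ring). lra.
    + apply C11_affine.
    + apply C11_clog. lra.
Qed.

(** Continuity of the logarithm at 1, in the form that selects the relative radius [eps]: moving [z]
    to [z (1 + u)] then displaces [log z] by at most [delta]. *)
Lemma clog_1_plus_small (delta : R) : 0 < delta ->
  exists eps, 0 < eps <= / 2 /\ forall u, Cmod u <= eps -> Cmod (clog (1 + u)) <= delta.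
Proof.
  intros Hd. destruct C11_clog_1_plus as (K & HK & H).
  exists (Rmin (/ 2) (delta / (K + 1))).
  assert (Hq : 0 < delta / (K + 1)) by (apply Rdiv_lt_0_compat; lra).
  split; [split; [apply Rmin_glb_lt; lra | apply Rmin_l]|].
  intros u Hu.
  assert (H1 : Cmod u <= / 2) by (eapply Rle_trans; [exact Hu | apply Rmin_l]).
  assert (H2 : Cmod u <= delta / (K + 1)) by (eapply Rle_trans; [exact Hu | apply Rmin_r]).
  assert (H0 : Cmod 0 <= / 2) by (rewrite Cmod_0; lra).
  destruct (H 0%C H0) as [_ H3]. destruct (H3 u H1) as [H4 _].
  replace (1 + 0)%C with (RtoC 1) in H4 by ring. rewrite clog_1 in H4.
  replace (clog (1 + u) - 0)%C with (clog (1 + u)) in H4 by ring.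
  replace (u - 0)%C with u in H4 by ring.
  eapply Rle_trans; [exact H4|].
  apply Rle_trans with (K * (delta / (K + 1))); [apply Rmult_le_compat_l; auto|].
  apply Rmult_le_reg_r with (K + 1); [lra|].
  unfold Rdiv. rewrite !Rmult_assoc, Rinv_l by lra. nra.
Qed.

(* [e^(s + circle_log eps t) = e^s (1 + eps e^(i t))]: in the logarithmic
   coordinate, the circles of centre [z] and radius [eps |z|] are translates of
   a single curve. *)
Definition circle_log (eps : R) (t : C) : C := clog (1 + RtoC eps * cexp (RtoC 1 * Ci * t)).

(** With [f (e^s) = g s] and [z = e^s], this is the Fourier coefficient of [f (z + eps z e^(it))],
    that is, [2 PI (eps z)^n f^(n)(z) / n!]. *)
Definition fourier (g : C -> C) (eps : R) (n : nat) (s : C) : C :=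
  cint (fun t => g (s + circle_log eps t) * cexp (RtoC (- INR n) * Ci * t))%C.

Lemma C11_circle_log (eps : R) : 0 < eps <= / 2 ->
  C11 real_axis (circle_log eps)
    (fun t => / (1 + RtoC eps * cexp (RtoC 1 * Ci * t))
              * (RtoC eps * (cexp (RtoC 1 * Ci * t) * (RtoC 1 * Ci))))%C.
Proof.
  intros He.
  apply (C11_comp real_axis _ (fun t => RtoC eps * cexp (RtoC 1 * Ci * t))%C _ _ _)
    with (3 := C11_clog_1_plus).
  - intros t Ht. rewrite Cmod_mult, Cmod_unit_circle, Cmod_R, Rabs_pos_eq by (auto; lra). lra.
  - apply C11_scal_l, C11_unit_circle.
Qed.

Lemma circle_log_end (eps : R) : circle_log eps (RtoC (2 * PI)) = circle_log eps (RtoC 0).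
Proof.
  unfold circle_log. rewrite (proj1 (unit_circle_end 1) : cexp (RtoC 1 * Ci * RtoC (2 * PI)) = 1%C).
  replace (RtoC 1 * Ci * RtoC 0)%C with (RtoC 0) by ring. rewrite cexp_0. reflexivity.
Qed.

(** * Derivatives as Fourier coefficients on small circles *)

Section Cauchy.

Variables (V : C -> Prop) (g g' : C -> C) (eps : R).
Hypothesis Hg : C11 V g g'.
Hypothesis Bg : bounded_on V g.
Hypothesis Heps : 0 < eps <= / 2.

(** The whole closed disc is required, not only its boundary circle, because the mean value property
    shrinks the circle to its centre. *)
Let around (s : C) : Prop := forall u, Cmod u <= eps -> V (s + clog (1 + u))%C.

Lemma around_circle (s t : C) : around s -> real_axis t -> V (s + circle_log eps t)%C.
Proof.
  intros Hs Ht. apply Hs.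
  rewrite Cmod_mult, Cmod_unit_circle, Cmod_R, Rabs_pos_eq by (auto; lra). lra.
Qed.

Lemma C11_around_circle (s : C) : around s ->
  C11 real_axis (fun t => g (s + circle_log eps t)%C)
    (fun t => g' (s + circle_log eps t) *
       (/ (1 + RtoC eps * cexp (RtoC 1 * Ci * t))
         * (RtoC eps * (cexp (RtoC 1 * Ci * t) * (RtoC 1 * Ci)))))%C.
Proof.
  intros Hs.
  apply (C11_comp real_axis V (fun t => s + circle_log eps t)%C _ g g'); auto.
  - intros t Ht; apply around_circle; auto.
  - apply C11_ext with
      (f := fun t => (1 * circle_log eps t + s)%C)
      (f' := fun t => (1 * (/ (1 + RtoC eps * cexp (RtoC 1 * Ci * t))
              * (RtoC eps * (cexp (RtoC 1 * Ci * t) * (RtoC 1 * Ci)))))%C).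
    + intros; ring.
    + intros; ring.
    + apply (C11_comp real_axis (fun _ => True) (circle_log eps) _ (fun w => 1 * w + s)%C (fun _ => 1%C)) ; auto.
      * apply C11_circle_log, Heps.
      * apply C11_affine.
Qed.

Lemma bounded_around_circle (f : C -> C) (s : C) : around s -> bounded_on V f ->
  bounded_on real_axis (fun t => f (s + circle_log eps t)%C).
Proof.
  intros Hs. apply bounded_on_comp. intros t Ht; apply around_circle; auto.
Qed.

Lemma lipschitz_fourier (f : C -> C) (s : C) (n : nat) : around s ->
  bounded_on V f -> lipschitz_on V f ->
  lipschitz_on real_axis (fun t => f (s + circle_log eps t) * cexp (RtoC (- INR n) * Ci * t))%C.
Proof.
  intros Hs Bf Lf. apply lipschitz_on_mult.
  - apply bounded_around_circle; auto.
  - apply bounded_on_circle.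
  - apply (lipschitz_on_comp real_axis V (fun t => s + circle_log eps t)%C f); auto.
    + intros t Ht; apply around_circle; auto.
    + destruct (C11_lipschitz _ _ _ (C11_circle_log eps Heps)) as (K & HK & H).
      exists K; split; auto. intros t t' Ht Ht'.
      replace (s + circle_log eps t' - (s + circle_log eps t))%C
        with (circle_log eps t' - circle_log eps t)%C by ring. auto.
  - apply (C11_lipschitz _ _ _ (C11_unit_circle _)).
Qed.

(** The mean value property of [u => g (s + clog (1 + u))] on the disc of radius [eps]. *)
Lemma fourier_0 (s : C) : around s -> fourier g eps 0 s = (2 * PI * g s)%C.
Proof.
  intros Hs.
  pose proof (mean_value_circle (fun u => g (s + clog (1 + u))%C)
    (fun u => g' (s + clog (1 + u)) * / (1 + u))%C eps) as H.
  cbv beta in H. replace (1 + 0)%C with (RtoC 1) in H by ring.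
  rewrite clog_1 in H. replace (s + 0)%C with s in H by ring.
  rewrite <- H.
  - apply cint_ext. intros t Ht. unfold circle_log.
    replace (RtoC (- INR 0) * Ci * t)%C with (RtoC 0) by (simpl INR; rewrite Ropp_0; ring).
    rewrite cexp_0. ring.
  - lra.
  - apply (C11_comp (fun u => Cmod u <= eps) V (fun u => s + clog (1 + u))%C (fun u => / (1 + u))%C g g'); auto.
    apply C11_ext with (f := fun u => (1 * clog (1 + u) + s)%C) (f' := fun u => (1 * / (1 + u))%C);
      [intros; ring | intros; ring |].
    apply (C11_comp _ (fun _ => True) (fun u => clog (1 + u)) _ (fun w => 1 * w + s)%C (fun _ => 1%C)); auto.
    + apply C11_subset with (2 := C11_clog_1_plus). intros u Hu; lra.
    + apply C11_affine.
  - apply (bounded_on_comp _ V (fun u => s + clog (1 + u))%C g); auto.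
Qed.

(** Integration by parts in [t]. With [c = e^(it)], the [t]-derivative of [g] along the circle is
    [g'] times [i eps c / (1 + eps c)], so [g'] is that derivative times [-i / (eps c) - i]. Against
    [e^(-int)] this produces the frequencies [n + 1] and [n], and moving the derivative onto the
    exponentials yields the factors [n + 1] and [n]. In this way [g] is never differentiated more
    than once. *)
Lemma cint_by_parts (s : C) (n : nat) : around s ->
  cint (fun t => g' (s + circle_log eps t) * cexp (RtoC (- INR n) * Ci * t))%C =
  (RtoC (INR n + 1) / RtoC eps * fourier g eps (S n) s + RtoC (INR n) * fourier g eps n s)%C.
Proof.
  intros Hs.
  set (Phi' := fun t => (g' (s + circle_log eps t) *
       (/ (1 + RtoC eps * cexp (RtoC 1 * Ci * t))
         * (RtoC eps * (cexp (RtoC 1 * Ci * t) * (RtoC 1 * Ci)))))%C).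
  assert (P : forall m, C11 real_axis
     (fun t => g (s + circle_log eps t) * cexp (RtoC (- INR m) * Ci * t))%C
     (fun t => Phi' t * cexp (RtoC (- INR m) * Ci * t)
       + g (s + circle_log eps t) * (cexp (RtoC (- INR m) * Ci * t) * (RtoC (- INR m) * Ci)))%C).
  { intros m. apply C11_mult.
    - apply bounded_around_circle; auto.
    - apply bounded_on_circle.
    - apply C11_around_circle, Hs.
    - apply C11_unit_circle. }
  assert (Z : forall m, cint (fun t => Phi' t * cexp (RtoC (- INR m) * Ci * t)
       + g (s + circle_log eps t) * (cexp (RtoC (- INR m) * Ci * t) * (RtoC (- INR m) * Ci)))%C = 0%C).
  { intros m. rewrite (cint_derivative _ _ (P m)). rewrite circle_log_end, (proj2 (unit_circle_end m)).
    replace (RtoC (- INR m) * Ci * RtoC 0)%C with (RtoC 0) by ring. rewrite cexp_0. ring. }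
  pose proof (C11_bounded_derivative _ _ _ Hg) as Bg'.
  pose proof (C11_lipschitz_derivative _ _ _ Hg) as Lg'.
  pose proof (C11_lipschitz _ _ _ Hg) as Lg.
  assert (LP : forall m, lipschitz_on real_axis (fun t => Phi' t * cexp (RtoC (- INR m) * Ci * t)
       + g (s + circle_log eps t) * (cexp (RtoC (- INR m) * Ci * t) * (RtoC (- INR m) * Ci)))%C)
    by (intros m; apply (C11_lipschitz_derivative _ _ _ (P m))).
  pose proof (lipschitz_on_scal real_axis) as Lsc.
  pose proof (lipschitz_on_plus real_axis) as Lpl.
  assert (Lf : forall m, lipschitz_on real_axis
     (fun t => g (s + circle_log eps t) * cexp (RtoC (- INR m) * Ci * t))%C)
    by (intros m; apply lipschitz_fourier; auto).
  assert (He0 : RtoC eps <> 0%C) by (intros A; apply (f_equal fst) in A; simpl in A; lra).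
  (* The first two summands are total derivatives, of zero integral by [Z]; their coefficients are
     the two terms of [-i / (eps c) - i]. The last two are what the product rule leaves over. *)
  transitivity (cint (fun t =>
    ((- Ci / RtoC eps) * (Phi' t * cexp (RtoC (- INR (S n)) * Ci * t)
       + g (s + circle_log eps t) * (cexp (RtoC (- INR (S n)) * Ci * t) * (RtoC (- INR (S n)) * Ci)))
     + (- Ci) * (Phi' t * cexp (RtoC (- INR n) * Ci * t)
       + g (s + circle_log eps t) * (cexp (RtoC (- INR n) * Ci * t) * (RtoC (- INR n) * Ci))))
    + (RtoC (INR n + 1) / RtoC eps * (g (s + circle_log eps t) * cexp (RtoC (- INR (S n)) * Ci * t))
       + RtoC (INR n) * (g (s + circle_log eps t) * cexp (RtoC (- INR n) * Ci * t))))%C).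
  - apply cint_ext. intros t Ht. unfold Phi'. rewrite S_INR.
    set (c := cexp (RtoC 1 * Ci * t)).
    assert (Hn : cexp (RtoC (- INR n) * Ci * t) = (c * cexp (RtoC (- (INR n + 1)) * Ci * t))%C).
    { unfold c. rewrite <- cexp_plus. f_equal. rewrite !RtoC_opp, RtoC_plus. ring. }
    rewrite Hn. set (e := cexp (RtoC (- (INR n + 1)) * Ci * t)).
    assert (Hq : (1 + RtoC eps * c)%C <> 0%C).
    { apply Re_pos_neq_0. unfold c.
      pose proof (re_le_Cmod (RtoC eps * cexp (RtoC 1 * Ci * t))) as A.
      rewrite Cmod_mult, Cmod_unit_circle, Cmod_R, (Rabs_pos_eq eps) in A by (auto; lra).
      apply Rabs_le_between in A.
      set (w := (RtoC eps * cexp (RtoC 1 * Ci * t))%C) in *.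
      replace (Re (1 + w)%C) with (1 + Re w) by (unfold Re; simpl; ring). lra. }
    assert (HCi : (Ci * Ci)%C = (- 1)%C) by (apply injective_projections; simpl; ring).
    rewrite !RtoC_opp, RtoC_plus.
    set (G' := g' (s + circle_log eps t)%C). set (G := g (s + circle_log eps t)%C).
    (* [field] treats [Ci] as an indeterminate. Adding this multiple of [Ci * Ci + 1], which is
       zero, makes the equality a rational identity. *)
    match goal with |- _ = ?rhs => transitivity (rhs + (Ci * Ci + 1) * (G' * (c * e)
      - (INR n + 1) / eps * G * e - INR n * G * (c * e)))%C end.
    2:{ rewrite HCi. ring. }
    field. split; auto.
  - rewrite !cint_plus, !cint_scal by (repeat (apply LP || apply Lf || apply Lsc || apply Lpl)).
    rewrite !Z. fold (fourier g eps (S n) s). fold (fourier g eps n s). ring.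
Qed.

Lemma C11_fourier (U : C -> Prop) (n : nat) : (forall s, U s -> around s) ->
  C11 U (fourier g eps n)
    (fun s => RtoC (INR n + 1) / RtoC eps * fourier g eps (S n) s + RtoC (INR n) * fourier g eps n s)%C.
Proof.
  intros HU.
  apply C11_ext with
    (f := fun s => cint (fun t => g (1 * s + circle_log eps t) * cexp (RtoC (- INR n) * Ci * t))%C)
    (f' := fun s => cint (fun t => g' (1 * s + circle_log eps t) * (1 * cexp (RtoC (- INR n) * Ci * t)))%C).
  - intros s Hs. apply cint_ext. intros t Ht. rewrite Cmult_1_l. reflexivity.
  - intros s Hs. rewrite <- cint_by_parts by auto.
    apply cint_ext. intros t Ht. rewrite !Cmult_1_l. reflexivity.
  - apply (C11_cint U V g g' (fun _ => 1%C) (circle_log eps) (fun t => cexp (RtoC (- INR n) * Ci * t))); auto.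
    + apply bounded_on_const.
    + apply lipschitz_on_const.
    + apply (C11_lipschitz _ _ _ (C11_circle_log eps Heps)).
    + apply bounded_on_circle.
    + apply (C11_lipschitz _ _ _ (C11_unit_circle _)).
    + intros s t Hs Ht. rewrite Cmult_1_l. apply around_circle; auto.
Qed.

Lemma Cmod_fourier_le (s : C) (n : nat) (B : R) : around s ->
  (forall u, Cmod u <= eps -> Cmod (g (s + clog (1 + u))%C) <= B) ->
  Cmod (fourier g eps n s) <= 2 * (2 * PI * B).
Proof.
  intros Hs HB. apply Cmod_cint_le.
  - apply lipschitz_fourier; auto. apply (C11_lipschitz _ _ _ Hg).
  - intros t Ht. rewrite Cmod_mult, Cmod_unit_circle, Rmult_1_r by assumption.
    apply HB. rewrite Cmod_mult, Cmod_unit_circle, Cmod_R, Rabs_pos_eq by (auto; lra). lra.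
Qed.

(* Cauchy's integral for the [n]-th derivative with respect to [z = e^s]. *)
Definition cauchy_derivative (n : nat) (s : C) : C :=
  (RtoC (INR (fact n) / (2 * PI * eps ^ n)) * (cexp (RtoC (- INR n) * s) * fourier g eps n s))%C.

Lemma cauchy_derivative_0 (s : C) : around s -> cauchy_derivative 0 s = g s.
Proof.
  intros Hs. unfold cauchy_derivative. rewrite fourier_0 by assumption.
  replace (RtoC (- INR 0) * s)%C with (RtoC 0) by (simpl INR; rewrite Ropp_0; ring).
  rewrite cexp_0. pose proof PI_neq0. simpl INR. simpl pow.
  replace (1 / (2 * PI * 1)) with (/ (2 * PI)) by (field; auto).
  rewrite RtoC_inv, RtoC_mult by nra.
  field. intros A; apply (f_equal fst) in A; simpl in A; lra.
Qed.

(** The factor [cexp s] appears because [d/ds = z d/dz]. Differentiating [e^(-ns)] gives [-n], which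
    cancels the term in [fourier g eps n] from [C11_fourier]; the remaining factor [(n + 1) / eps]
    turns the normalisation for [n] into the one for [S n]. The bound [R0] keeps [e^(-ns)]
    bounded. *)
Lemma C11_cauchy_derivative (U : C -> Prop) (n : nat) (R0 : R) :
  (forall s, U s -> around s) -> (forall s, U s -> R0 <= Re s) ->
  C11 U (cauchy_derivative n) (fun s => cexp s * cauchy_derivative (S n) s)%C.
Proof.
  intros HU HR. pose proof PI_RGT_0.
  assert (Hx : forall s, U s -> Re (RtoC (- INR n) * s)%C <= - INR n * R0).
  { intros s Hs. replace (Re (RtoC (- INR n) * s)%C) with (- INR n * Re s) by (unfold Re; simpl; ring).
    specialize (HR s Hs). pose proof (pos_INR n). nra. }
  assert (HE : C11 U (fun s => cexp (RtoC (- INR n) * s))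
     (fun s => cexp (RtoC (- INR n) * s) * RtoC (- INR n))%C).
  { apply (C11_comp U (fun w => Re w <= - INR n * R0) (fun s => RtoC (- INR n) * s)%C (fun _ => RtoC (- INR n))); auto.
    - apply C11_ext with (f := fun s => (RtoC (- INR n) * s + 0)%C) (f' := fun _ => RtoC (- INR n));
       [intros; ring | reflexivity | apply C11_affine].
    - apply C11_cexp. }
  assert (He0 : RtoC eps <> 0%C) by (intros A; apply (f_equal fst) in A; simpl in A; lra).
  eapply C11_ext; [reflexivity | | apply C11_scal_l, C11_mult; [ | | exact HE | apply (C11_fourier U n HU)]].
  - intros s Hs. cbv beta. unfold cauchy_derivative.
    assert (E : cexp (RtoC (- INR n) * s) = (cexp s * cexp (RtoC (- INR (S n)) * s))%C).
    { rewrite <- cexp_plus. f_equal. rewrite S_INR, !RtoC_opp, RtoC_plus. ring. }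
    replace (RtoC (INR (fact (S n)) / (2 * PI * eps ^ S n))) with
      (RtoC (INR (fact n) / (2 * PI * eps ^ n)) * (RtoC (INR n + 1) / RtoC eps))%C.
    + rewrite E. rewrite !RtoC_opp. field. exact He0.
    + rewrite <- RtoC_div, <- RtoC_mult by lra. f_equal.
      change (fact (S n)) with (S n * fact n)%nat. rewrite mult_INR, S_INR. simpl pow.
      assert (eps ^ n <> 0) by (apply pow_nonzero; lra). field. repeat split; lra.
  - exists (exp (- INR n * R0)); split; [left; apply exp_pos|].
    intros s Hs. rewrite Cmod_cexp. destruct (Hx s Hs) as [h|h].
    + left; apply exp_increasing, h.
    + rewrite h; lra.
  - destruct Bg as (B & HB & H1). exists (2 * (2 * PI * B)).
    split; [apply Rmult_le_pos; [lra|]; apply Rmult_le_pos; lra|].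
    intros s Hs. apply Cmod_fourier_le; auto. intros u Hu. apply H1, HU; auto.
Qed.

(** Cauchy's estimate for functions of size [|z|^n B] near [z]: the factor [exp (Re s) ^ n] cancels
    [e^(-ns)], so the bound does not depend on [s]. *)
Lemma Cmod_cauchy_derivative_le (s : C) (n : nat) (B : R) : around s ->
  (forall u, Cmod u <= eps -> Cmod (g (s + clog (1 + u))%C) <= exp (Re s) ^ n * B) ->
  Cmod (cauchy_derivative n s) <= 2 * INR (fact n) * B * (/ eps) ^ n.
Proof.
  intros Hs HB. unfold cauchy_derivative. pose proof PI_RGT_0.
  pose proof (INR_fact_lt_0 n) as Hf.
  assert (Hen : 0 < eps ^ n) by (apply pow_lt; lra).
  assert (Hc : 0 < INR (fact n) / (2 * PI * eps ^ n)) by (apply Rdiv_lt_0_compat; nra).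
  rewrite !Cmod_mult, Cmod_R, Rabs_pos_eq, Cmod_cexp by lra.
  assert (Ex : exp (Re (RtoC (- INR n) * s)%C) * exp (Re s) ^ n = 1).
  { rewrite <- Rpower_pow by apply exp_pos. unfold Rpower. rewrite ln_exp, <- exp_plus.
    rewrite <- exp_0. f_equal. unfold Re; simpl. ring. }
  pose proof (Cmod_fourier_le s n _ Hs HB) as F.
  set (x := exp (Re (RtoC (- INR n) * s)%C)) in *. assert (0 < x) by apply exp_pos.
  apply Rle_trans with (INR (fact n) / (2 * PI * eps ^ n) * (x * (2 * (2 * PI * (exp (Re s) ^ n * B))))).
  - apply Rmult_le_compat_l; [lra|]. apply Rmult_le_compat_l; lra.
  - right. rewrite pow_inv.
    replace (x * (2 * (2 * PI * (exp (Re s) ^ n * B)))) with (2 * (2 * PI * (x * exp (Re s) ^ n * B))) by ring.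
    rewrite Ex. field. lra.
Qed.

End Cauchy.

(** * From the logarithmic coordinate to the surface *)

Definition log_coord (z : Sigma) : C := (ln (modulus z), Arg z).

Lemma cexp_log_coord (z : Sigma) : 0 < modulus z -> cexp (log_coord z) = proj z.
Proof.
  intros Hz. unfold cexp, log_coord, proj, Re, Im; simpl. rewrite exp_ln by exact Hz. reflexivity.
Qed.

(** Let [h], [p] and [e] be the increments of [s], [f] and [cexp], and [q = cexp s0]. Then
    [p/e - f'/q] equals [(q (p - f' h) - f' (e - q h)) / (e q)]. The numerator is quadratic in [h],
    while the denominator is at least [|q|^2 |h| / 2] for small [h], so the difference is of order
    [|h|]. *)
Lemma C11_is_Sderive (U : C -> Prop) (f f' : C -> C) (z : Sigma) (d : R) :
  0 < modulus z -> 0 < d -> C11 U f f' ->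
  (forall s, Cmod (s - log_coord z) < d -> U s) ->
  is_Sderive (fun x => f (log_coord x)) z (f' (log_coord z) / cexp (log_coord z))%C.
Proof.
  intros Hz Hd (K & HK & H) HU.
  set (s0 := log_coord z) in *.
  destruct (C11_cexp (Re s0 + 1)) as (L & HL & HE).
  assert (E0 : Re s0 <= Re s0 + 1) by lra.
  assert (U0 : U s0).
  { apply HU. replace (s0 - s0)%C with (RtoC 0) by ring. rewrite Cmod_0; exact Hd. }
  destruct (H s0 U0) as [_ Hf]. destruct (HE s0 E0) as [_ He].
  set (q := cexp s0) in *. assert (Hq : 0 < Cmod q) by (apply Cmod_gt_0, cexp_neq_0).
  set (C0 := Cmod q * K + Cmod (f' s0) * L).
  pose proof (Cmod_ge_0 (f' s0)) as Hf0.
  assert (HC0 : 0 <= C0) by (unfold C0; nra).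
  assert (Q : forall s, U s -> s <> s0 -> Cmod (s - s0) <= 1 -> L * Cmod (s - s0) <= Cmod q / 2 ->
    Cmod ((f s - f s0) / (cexp s - q) - f' s0 / q)%C <= 2 * C0 / (Cmod q * Cmod q) * Cmod (s - s0)).
  { intros s Us Hs H1 H2.
    assert (Hp : 0 < Cmod (s - s0)).
    { apply Cmod_gt_0. intros A. apply Hs. replace s with (s - s0 + s0)%C by ring. rewrite A; ring. }
    destruct (Hf s Us) as [_ Hf2].
    assert (Es : Re s <= Re s0 + 1).
    { pose proof (re_le_Cmod (s - s0)) as A. apply Rabs_le_between in A.
      change (Re (s - s0)%C) with (Re s - Re s0) in A. lra. }
    destruct (He s Es) as [_ He2].
    set (p := (f s - f s0)%C) in *. set (e := (cexp s - q)%C) in *. set (h := (s - s0)%C) in *.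
    assert (He3 : Cmod q / 2 * Cmod h <= Cmod e).
    { assert (A : Cmod (q * h) <= Cmod e + Cmod (e - q * h)).
      { replace (q * h)%C with (e + - (e - q * h))%C by ring.
        eapply Rle_trans; [apply Cmod_triangle|]. rewrite Cmod_opp.
        replace (e + - (e - q * h))%C with (q * h)%C by ring. lra. }
      rewrite Cmod_mult in A. simpl pow in He2. nra. }
    assert (He4 : 0 < Cmod e) by nra.
    assert (e <> 0%C) by (apply Cmod_gt_0, He4). assert (q <> 0%C) by (apply Cmod_gt_0, Hq).
    replace (p / e - f' s0 / q)%C with
      ((q * (p - f' s0 * h) - f' s0 * (e - q * h)) / (e * q))%C by (field; auto).
    rewrite Cmod_div by (apply Cmult_neq_0; auto). rewrite Cmod_mult.
    assert (N : Cmod (q * (p - f' s0 * h) - f' s0 * (e - q * h)) <= C0 * Cmod h ^ 2).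
    { eapply Rle_trans; [apply Cmod_triangle|]. rewrite Cmod_opp, !Cmod_mult. unfold C0.
      assert (Cmod q * Cmod (p - f' s0 * h) <= Cmod q * (K * Cmod h ^ 2))
        by (apply Rmult_le_compat_l; lra).
      assert (Cmod (f' s0) * Cmod (e - q * h) <= Cmod (f' s0) * (L * Cmod h ^ 2))
        by (apply Rmult_le_compat_l; lra). lra. }
    apply Rmult_le_reg_r with (Cmod e * Cmod q); [nra|].
    unfold Rdiv at 1. rewrite Rmult_assoc, Rinv_l, Rmult_1_r by nra.
    eapply Rle_trans; [exact N|].
    replace (C0 * Cmod h ^ 2) with (2 * C0 / (Cmod q * Cmod q) * Cmod h * ((Cmod q / 2 * Cmod h) * Cmod q))
      by (field; lra).
    apply Rmult_le_compat_l.
    - apply Rmult_le_pos; [|lra]. apply Rmult_le_pos; [lra|]. left; apply Rinv_0_lt_compat; nra.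
    - apply Rmult_le_compat_r; lra. }
  set (B := 2 * C0 / (Cmod q * Cmod q)) in Q.
  assert (HB : 0 <= B).
  { unfold B. apply Rmult_le_pos; [lra|]. left; apply Rinv_0_lt_compat; nra. }
  intros P [eps HP].
  (* The four bounds in order: stay in [U], stay in the half-plane where [cexp] is controlled, keep
     [|e| >= |q| |h| / 2], and make the final error smaller than [eps]. *)
  set (eta := Rmin (Rmin d 1) (Rmin (Cmod q / (2 * (L + 1))) (eps / (B + 1)))).
  pose proof (cond_pos eps) as Heps.
  assert (Heta : 0 < eta).
  { unfold eta. repeat apply Rmin_glb_lt; try lra; apply Rdiv_lt_0_compat; lra. }
  assert (Hln : continuous ln (modulus z)).
  { apply (ex_derive_continuous (V := R_NormedModule)). auto_derive; exact Hz. }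
  assert (Heta2 : 0 < eta / 2) by lra.
  destruct (Hln (ball (ln (modulus z)) (mkposreal _ Heta2)) (locally_ball _ _)) as [d1 Hd1].
  (* The bound by [modulus z] keeps [modulus x] positive, so that [log_coord x] is meaningful and
     injectivity of [ln] applies. *)
  assert (Hd2 : 0 < Rmin (Rmin d1 (eta / 2)) (modulus z)).
  { repeat apply Rmin_glb_lt; auto. apply cond_pos. }
  exists (mkposreal _ Hd2). intros x [Bx1 Bx2] Hx. simpl in Bx1, Bx2.
  assert (Bx1' : Rabs (modulus x - modulus z) < Rmin (Rmin d1 (eta / 2)) (modulus z)) by exact Bx1.
  assert (Bx2' : Rabs (Arg x - Arg z) < Rmin (Rmin d1 (eta / 2)) (modulus z)) by exact Bx2.
  assert (M1 : Rabs (modulus x - modulus z) < d1).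
  { eapply Rlt_le_trans; [exact Bx1'|]. eapply Rle_trans; apply Rmin_l. }
  assert (M2 : Rabs (modulus x - modulus z) < modulus z).
  { eapply Rlt_le_trans; [exact Bx1'|]. apply Rmin_r. }
  assert (M3 : Rabs (Arg x - Arg z) < eta / 2).
  { eapply Rlt_le_trans; [exact Bx2'|]. eapply Rle_trans; [apply Rmin_l | apply Rmin_r]. }
  assert (Hxm : 0 < modulus x) by (apply Rabs_lt_between in M2; lra).
  assert (M4 : Rabs (ln (modulus x) - ln (modulus z)) < eta / 2) by exact (Hd1 (modulus x) M1).
  assert (Hdist : Cmod (log_coord x - s0) < eta).
  { replace (log_coord x - s0)%C with
      (RtoC (ln (modulus x) - ln (modulus z)) + Ci * RtoC (Arg x - Arg z))%C
      by (unfold s0, log_coord; apply injective_projections; simpl; ring).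
    eapply Rle_lt_trans; [apply Cmod_triangle|].
    rewrite Cmod_mult, Cmod_Ci, !Cmod_R. lra. }
  assert (I1 : eta <= d) by (eapply Rle_trans; apply Rmin_l).
  assert (I2 : eta <= 1) by (eapply Rle_trans; [apply Rmin_l | apply Rmin_r]).
  assert (I3 : eta <= Cmod q / (2 * (L + 1))) by (eapply Rle_trans; [apply Rmin_r | apply Rmin_l]).
  assert (I4 : eta <= eps / (B + 1)) by (eapply Rle_trans; [apply Rmin_r | apply Rmin_r]).
  assert (Hne : log_coord x <> s0).
  { intros A. apply Hx. apply injective_projections.
    - apply (f_equal fst) in A. simpl in A. apply ln_inv in A; auto.
    - apply (f_equal snd) in A. exact A. }
  pose proof (Cmod_ge_0 (log_coord x - s0)) as Hge.
  assert (Hfin : Cmod ((f (log_coord x) - f s0) / (cexp (log_coord x) - q) - f' s0 / q)%C < eps).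
  { eapply Rle_lt_trans; [apply Q; auto|].
    - apply HU. lra.
    - lra.
    - apply Rle_trans with (L * (Cmod q / (2 * (L + 1)))); [apply Rmult_le_compat_l; lra|].
      apply Rmult_le_reg_r with (2 * (L + 1)); [lra|].
      replace (L * (Cmod q / (2 * (L + 1))) * (2 * (L + 1))) with (L * Cmod q) by (field; lra).
      replace (Cmod q / 2 * (2 * (L + 1))) with (Cmod q * (L + 1)) by field. nra.
    - apply Rle_lt_trans with (B * (eps / (B + 1))); [apply Rmult_le_compat_l; lra|].
      apply Rmult_lt_reg_r with (B + 1); [lra|].
      replace (B * (eps / (B + 1)) * (B + 1)) with (B * eps) by (field; lra). nra. }
  apply HP. rewrite <- (cexp_log_coord x), <- (cexp_log_coord z) by assumption. fold s0 q.
  set (w := ((f (log_coord x) - f s0) / (cexp (log_coord x) - q))%C) in *.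
  split.
  - eapply Rle_lt_trans; [|exact Hfin]. apply (re_le_Cmod (w - f' s0 / q)).
  - eapply Rle_lt_trans; [|exact Hfin]. apply (im_le_Cmod (w - f' s0 / q)).
Qed.

(** * The flat function *)

Lemma Series_nonneg (u : nat -> R) : (forall n, 0 <= u n) -> ex_series u -> 0 <= Series u.
Proof.
  intros H Hu. rewrite <- (Rmult_0_l (Series u)), <- Series_scal_l.
  apply Series_le; [|exact Hu]. intros n. specialize (H n). lra.
Qed.

Lemma exp_le_compat (x y : R) : x <= y -> exp x <= exp y.
Proof.
  intros [H|H]; [left; apply exp_increasing, H | rewrite H; lra].
Qed.

Section FlatFunction.

Variables (a : nat -> R) (gamma : R).
Hypothesis Ha : forall j, 0 < a j <= 1.
Hypothesis Hsum : ex_series a.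
Hypothesis Hgamma : 0 < gamma.

Let right_half (w : C) : Prop := 0 <= Re w.

(** A sum of principal logarithms rather than the logarithm of the product: the arguments of the
    factors may add up beyond the range of [clog]. *)
Definition log_product (w : C) : C := Cseries (fun j => clog (1 + RtoC (a j) * w)).

Lemma Re_factor (j : nat) (w : C) : right_half w -> 1 <= Re (1 + RtoC (a j) * w)%C.
Proof.
  intros Hw. destruct (Ha j) as [H1 H2].
  replace (Re (1 + RtoC (a j) * w)%C) with (1 + a j * Re w) by (unfold Re; simpl; ring).
  unfold right_half in Hw. nra.
Qed.

(** All factors lie in the half-plane [1 <= Re q], so a single constant for [clog] serves every [j].
    The chain rule brings out [a j], which makes the bounds summable; in the quadratic term it
    brings out the square, and [a j <= 1] reduces it to [a j]. *)
Lemma C11_factor : exists K, 0 <= K /\ forall j w, right_half w ->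
  Cmod (RtoC (a j) / (1 + RtoC (a j) * w))%C <= K * a j /\
  forall w', right_half w' ->
    Cmod (clog (1 + RtoC (a j) * w') - clog (1 + RtoC (a j) * w)) <= K * a j * Cmod (w' - w) /\
    Cmod (clog (1 + RtoC (a j) * w') - clog (1 + RtoC (a j) * w)
          - RtoC (a j) / (1 + RtoC (a j) * w) * (w' - w)) <= K * a j * Cmod (w' - w) ^ 2.
Proof.
  destruct (C11_clog 1 Rlt_0_1) as (K & HK & H). exists K; split; [exact HK|].
  intros j w Hw. destruct (Ha j) as [A1 A2].
  destruct (H _ (Re_factor j w Hw)) as [H1 H2].
  assert (N : (1 + RtoC (a j) * w)%C <> 0%C).
  { apply Re_pos_neq_0. pose proof (Re_factor j w Hw). lra. }
  split.
  - unfold Cdiv. rewrite Cmod_mult, Cmod_R, Rabs_pos_eq by lra. nra.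
  - intros w' Hw'. destruct (H2 _ (Re_factor j w' Hw')) as [H3 H4].
    replace (1 + RtoC (a j) * w' - (1 + RtoC (a j) * w))%C with (RtoC (a j) * (w' - w))%C in H3, H4 by ring.
    rewrite Cmod_mult, Cmod_R, Rabs_pos_eq in H3, H4 by lra.
    split; [rewrite Rmult_assoc; exact H3|].
    replace (RtoC (a j) / (1 + RtoC (a j) * w) * (w' - w))%C with
      (/ (1 + RtoC (a j) * w) * (RtoC (a j) * (w' - w)))%C by (field; exact N).
    eapply Rle_trans; [exact H4|]. rewrite Rmult_assoc. apply Rmult_le_compat_l; [exact HK|].
    pose proof (pow2_ge_0 (Cmod (w' - w))). rewrite Rpow_mult_distr. nra.
Qed.

Lemma ex_log_product (w : C) : right_half w -> ex_Cseries (fun j => clog (1 + RtoC (a j) * w)).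
Proof.
  intros Hw. destruct C11_factor as (K & HK & H).
  apply ex_Cseries_le with (fun j => K * a j * Cmod w).
  - intros j. assert (H0 : right_half 0) by (unfold right_half, Re; simpl; lra).
    destruct (H j 0%C H0) as [_ H1]. destruct (H1 w Hw) as [H2 _].
    replace (1 + RtoC (a j) * 0)%C with (RtoC 1) in H2 by ring. rewrite clog_1 in H2.
    replace (clog (1 + RtoC (a j) * w) - 0)%C with (clog (1 + RtoC (a j) * w)) in H2 by ring.
    replace (w - 0)%C with w in H2 by ring. exact H2.
  - apply ex_series_scal_r. exact (ex_series_scal_l K a Hsum).
Qed.

Lemma C11_log_product : C11 right_half log_product
  (fun w => Cseries (fun j => RtoC (a j) / (1 + RtoC (a j) * w))%C).
Proof.
  destruct C11_factor as (K & HK & H).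
  apply (C11_Cseries right_half (fun j w => clog (1 + RtoC (a j) * w))
    (fun j w => RtoC (a j) / (1 + RtoC (a j) * w))%C (fun j => K * a j)).
  - exact (ex_series_scal_l K a Hsum).
  - apply ex_log_product.
  - intros j w Hw. apply H, Hw.
Qed.

Lemma ln_factor_nonneg (j : nat) (w : C) : right_half w ->
  0 <= ln (Cmod (1 + RtoC (a j) * w)).
Proof.
  intros Hw. rewrite <- ln_1. apply ln_le; [lra|].
  eapply Rle_trans; [apply Re_factor; exact Hw | apply Re_le_Cmod].
Qed.

Lemma ex_series_ln_factor (w : C) : right_half w ->
  ex_series (fun j => ln (Cmod (1 + RtoC (a j) * w))).
Proof.
  intros Hw. destruct (ex_log_product w Hw) as [H _].
  apply ex_series_ext with (2 := H). intros j. apply Re_clog.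
  pose proof (Re_factor j w Hw). lra.
Qed.

Lemma Re_log_product (w : C) : right_half w ->
  Re (log_product w) = Series (fun j => ln (Cmod (1 + RtoC (a j) * w))).
Proof.
  intros Hw. apply Series_ext. intros j. apply Re_clog.
  pose proof (Re_factor j w Hw). lra.
Qed.

Lemma Re_log_product_nonneg (w : C) : right_half w -> 0 <= Re (log_product w).
Proof.
  intros Hw. rewrite Re_log_product by exact Hw.
  apply Series_nonneg; [intros j; apply ln_factor_nonneg, Hw | apply ex_series_ln_factor, Hw].
Qed.

(* In the coordinate [s = log z] this is the function
   [prod_j (1 + a_j z^(-1/gamma))^(-gamma)]. *)
Definition flat (s : C) : C :=
  cexp (RtoC (- gamma) * log_product (cexp (RtoC (- / gamma) * s))).

Definition strip (s : C) : Prop := Rabs (Im s) < gamma * PI / 2.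

(** Division by [gamma] brings the imaginary part between [- PI / 2] and [PI / 2], where the cosine
    is nonnegative. *)
Lemma strip_right_half (s : C) : strip s -> right_half (cexp (RtoC (- / gamma) * s)).
Proof.
  intros Hs. unfold right_half, cexp.
  replace (Im (RtoC (- / gamma) * s)%C) with (- (/ gamma * Im s)) by (unfold Im; simpl; ring).
  rewrite cos_neg. unfold Re at 1; simpl fst.
  apply Rmult_le_pos; [left; apply exp_pos|].
  apply Rabs_def2 in Hs. assert (Hi : 0 < / gamma) by (apply Rinv_0_lt_compat, Hgamma).
  replace (gamma * PI / 2) with (gamma * (PI / 2)) in Hs by field.
  apply cos_ge_0.
  - apply Rmult_le_reg_l with gamma; [exact Hgamma|].
    rewrite <- Rmult_assoc, Rinv_r by lra. lra.
  - apply Rmult_le_reg_l with gamma; [exact Hgamma|].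
    rewrite <- Rmult_assoc, Rinv_r by lra. lra.
Qed.

(** The cut at [R0] is needed for the inner exponential [z^(-1/gamma)], which is unbounded near the
    vertex. The outer exponential needs no cut, since its exponent has real part at most 0. *)
Lemma C11_flat (R0 : R) : exists flat',
  C11 (fun s => strip s /\ R0 <= Re s) flat flat'.
Proof.
  assert (Hi : 0 < / gamma) by (apply Rinv_0_lt_compat, Hgamma).
  eexists.
  eapply (C11_comp _ (fun w => Re w <= 0)
    (fun s => RtoC (- gamma) * log_product (cexp (RtoC (- / gamma) * s)))%C); [| | apply C11_cexp].
  - intros s [Hs _]. pose proof (Re_log_product_nonneg _ (strip_right_half s Hs)).
    match goal with |- Re (?c * ?w)%C <= 0 =>
      replace (Re (c * w)%C) with (- gamma * Re w) by (unfold Re; simpl; ring) end. nra.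
  - apply C11_scal_l.
    eapply (C11_comp _ right_half (fun s => cexp (RtoC (- / gamma) * s)));
      [| | apply C11_log_product].
    + intros s [Hs _]. apply strip_right_half, Hs.
    + eapply (C11_comp _ (fun w => Re w <= - / gamma * R0) (fun s => RtoC (- / gamma) * s)%C
        (fun _ => RtoC (- / gamma))); [| | apply C11_cexp].
      * intros s [_ Hs].
        replace (Re (RtoC (- / gamma) * s)%C) with (- / gamma * Re s) by (unfold Re; simpl; ring). nra.
      * apply C11_ext with (f := fun s => (RtoC (- / gamma) * s + 0)%C) (f' := fun _ => RtoC (- / gamma));
          [intros; ring | reflexivity | apply C11_affine].
Qed.

Lemma Cmod_flat (s : C) : strip s ->
  Cmod (flat s) =
  exp (- gamma * Series (fun j => ln (Cmod (1 + RtoC (a j) * cexp (RtoC (- / gamma) * s))))).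
Proof.
  intros Hs. unfold flat. rewrite Cmod_cexp, <- Re_log_product by (apply strip_right_half, Hs).
  f_equal. unfold Re; simpl; ring.
Qed.

Lemma Cmod_flat_le_1 (s : C) : strip s -> Cmod (flat s) <= 1.
Proof.
  intros Hs. unfold flat. rewrite Cmod_cexp, <- exp_0.
  pose proof (Re_log_product_nonneg _ (strip_right_half s Hs)).
  match goal with |- exp (Re (?c * ?w)%C) <= _ =>
      replace (Re (c * w)%C) with (- gamma * Re w) by (unfold Re; simpl; ring) end.
  apply exp_le_compat. nra.
Qed.

Variable M : nat -> R.
Hypothesis HM0 : M 0%nat = 1.
Hypothesis HMpos : forall j, 0 < M j.
Hypothesis HMa : forall j, M (S j) = exp (- gamma * ln (a j)) * M j.

Lemma Cmod_power (s : C) (j : nat) :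
  Cmod (RtoC (a j) * cexp (RtoC (- / gamma) * s)) = exp (ln (a j) - Re s / gamma).
Proof.
  destruct (Ha j). rewrite Cmod_mult, Cmod_R, Rabs_pos_eq, Cmod_cexp by lra.
  unfold Rminus. rewrite exp_plus, exp_ln by lra. f_equal. f_equal. unfold Re; simpl. field. lra.
Qed.

Lemma Cmod_flat_le (s : C) (n : nat) : strip s -> Cmod (flat s) <= exp (Re s) ^ n * M n.
Proof.
  intros Hs. rewrite Cmod_flat by exact Hs.
  set (w := cexp (RtoC (- / gamma) * s)).
  assert (Hw : right_half w) by (apply strip_right_half, Hs).
  set (L := fun j => ln (Cmod (1 + RtoC (a j) * w))).
  assert (HL : ex_series L) by (apply ex_series_ln_factor, Hw).
  assert (HL0 : forall j, 0 <= L j) by (intros j; apply ln_factor_nonneg, Hw).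
  assert (step : forall j, exp (- gamma * L j) <= exp (Re s) * exp (- gamma * ln (a j))).
  { intros j. rewrite <- exp_plus. apply exp_le_compat.
    assert (ln (a j) - Re s / gamma <= L j).
    { rewrite <- (ln_exp (ln (a j) - Re s / gamma)). apply ln_le; [apply exp_pos|].
      rewrite <- Cmod_power. fold w. set (p := (RtoC (a j) * w)%C).
      assert (Hp : 0 <= Re p).
      { unfold p. replace (Re (RtoC (a j) * w)%C) with (a j * Re w) by (unfold Re; simpl; ring).
        destruct (Ha j). apply Rmult_le_pos; [lra | exact Hw]. }
      apply Rsqr_incr_0_var; [|apply Cmod_ge_0].
      rewrite !Rsqr_pow2, !Cmod2_alt.
      replace (Re (1 + p)%C) with (1 + Re p) by (unfold Re; simpl; ring).
      replace (Im (1 + p)%C) with (Im p) by (unfold Im; simpl; ring). nra. }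
    apply Rmult_le_compat_l with (r := gamma) in H; [|lra].
    replace (gamma * (ln (a j) - Re s / gamma)) with (gamma * ln (a j) - Re s) in H by (field; lra).
    lra. }
  (* Generalised to the product of the factors from [k] on: removing the first factor moves [k] to
     [S k], and the weight [M k] absorbs the quotient released by [HMa]. *)
  assert (G : forall n k, exp (- gamma * Series (fun j => L (k + j)%nat)) * M k
                          <= exp (Re s) ^ n * M (k + n)%nat).
  { clear n. induction n as [|n IH]; intros k.
    - rewrite Nat.add_0_r. apply Rmult_le_compat_r; [left; apply HMpos|].
      simpl pow. rewrite <- exp_0. apply exp_le_compat.
      assert (0 <= Series (fun j => L (k + j)%nat)).
      { apply Series_nonneg; [intros j; apply HL0|].
        apply (ex_series_incr_n (V := R_NormedModule) L k), HL. }
      nra.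
    - rewrite Series_incr_1 by (apply (ex_series_incr_n (V := R_NormedModule) L k), HL).
      rewrite Nat.add_0_r, Rmult_plus_distr_l, exp_plus.
      specialize (IH (S k)).
      rewrite (Series_ext _ (fun j => L (S k + j)%nat)) by (intros j; f_equal; lia).
      replace (k + S n)%nat with (S k + n)%nat by lia.
      rewrite HMa in IH. specialize (step k).
      set (T := exp (- gamma * Series (fun j => L (S k + j)%nat))) in *.
      assert (HT : 0 < T) by apply exp_pos.
      pose proof (HMpos k).
      apply Rle_trans with (exp (Re s) * (T * (exp (- gamma * ln (a k)) * M k))).
      + replace (exp (- gamma * L k) * T * M k) with (exp (- gamma * L k) * (T * M k)) by ring.
        replace (exp (Re s) * (T * (exp (- gamma * ln (a k)) * M k))) with
          (exp (Re s) * exp (- gamma * ln (a k)) * (T * M k)) by ring.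
        apply Rmult_le_compat_r; [nra | exact step].
      + simpl pow. rewrite Rmult_assoc. apply Rmult_le_compat_l; [left; apply exp_pos | exact IH]. }
  specialize (G n 0%nat). rewrite HM0, Rmult_1_r in G. exact G.
Qed.

Variable K : R.
Hypothesis HK : 0 <= K.
Hypothesis Htail : forall N, Series (fun k => a (N + k)%nat) <= K * (INR N + 1) * a N.

Lemma first_small (x : R) : 0 < x ->
  exists N, x * a N <= 1 /\ forall j, (j < N)%nat -> 1 < x * a j.
Proof.
  intros Hx.
  assert (E : exists n, x * a n <= 1).
  { pose proof (ex_series_lim_0 a Hsum) as H.
    assert (Hix : 0 < / x) by (apply Rinv_0_lt_compat, Hx).
    destruct (proj2 (is_lim_seq_spec _ _) H (mkposreal _ Hix)) as [n Hn].
    exists n. specialize (Hn n (le_n n)). simpl in Hn. rewrite Rminus_0_r in Hn.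
    destruct (Ha n). rewrite Rabs_pos_eq in Hn by lra.
    apply Rmult_lt_compat_l with (r := x) in Hn; [|exact Hx]. rewrite Rinv_r in Hn by lra. lra. }
  destruct E as [n Hn].
  assert (S : forall n, (exists N, x * a N <= 1 /\ forall j, (j < N)%nat -> 1 < x * a j) \/
            (forall j, (j < n)%nat -> 1 < x * a j)).
  { clear n Hn. induction n as [|n [IH|IH]].
    - right; intros; lia.
    - left; exact IH.
    - destruct (Rle_lt_dec (x * a n) 1) as [h|h].
      + left. exists n; auto.
      + right. intros j Hj. destruct (Nat.eq_dec j n) as [->|]; [exact h | apply IH; lia]. }
  destruct (S (Datatypes.S n)) as [A|A]; [exact A|].
  specialize (A n (Nat.lt_succ_diag_r n)). lra.
Qed.

(** One index [N] is enough because [h M] is an infimum. For [j < N], [|1 + p_j| <= 2 |p_j|] costs a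
    factor [2^(-gamma)]. The tail cost [exp (- gamma * K * (N + 1))] is split: one factor
    [exp (- gamma * K)] stands in front and becomes [kappa1], the other [N] join the powers of
    [2^(-gamma)] and give [kappa2]. *)
Lemma Cmod_flat_ge (s : C) : strip s -> exists N : nat,
  exp (- gamma * K) * ((exp (- gamma * (ln 2 + K)) * exp (Re s)) ^ N * M N) <= Cmod (flat s).
Proof.
  intros Hs. rewrite Cmod_flat by exact Hs.
  set (w := cexp (RtoC (- / gamma) * s)).
  assert (Hw : right_half w) by (apply strip_right_half, Hs).
  set (L := fun j => ln (Cmod (1 + RtoC (a j) * w))).
  assert (HL : ex_series L) by (apply ex_series_ln_factor, Hw).
  assert (HL0 : forall j, 0 <= L j) by (intros j; apply ln_factor_nonneg, Hw).
  set (x := exp (- Re s / gamma)). assert (Hx : 0 < x) by apply exp_pos.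
  assert (Hp : forall j, Cmod (RtoC (a j) * w) = x * a j).
  { intros j. unfold w. rewrite Cmod_power. unfold Rminus. destruct (Ha j).
    rewrite exp_plus, exp_ln by lra. unfold x. rewrite Rmult_comm. f_equal. f_equal. field. lra. }
  assert (Hfac : forall j, Cmod (1 + RtoC (a j) * w) <= 1 + x * a j).
  { intros j. eapply Rle_trans; [apply Cmod_triangle|]. rewrite Cmod_1, Hp. lra. }
  assert (Hfac0 : forall j, 0 < Cmod (1 + RtoC (a j) * w)).
  { intros j. pose proof (Re_factor j w Hw). pose proof (Re_le_Cmod (1 + RtoC (a j) * w)%C). lra. }
  destruct (first_small x Hx) as [N [HN1 HN2]]. exists N.
  assert (step : forall j, (j < N)%nat ->
    exp (- gamma * ln 2) * exp (Re s) * exp (- gamma * ln (a j)) <= exp (- gamma * L j)).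
  { intros j Hj. specialize (HN2 j Hj). rewrite <- !exp_plus. apply exp_le_compat.
    destruct (Ha j) as [A1 A2].
    assert (L j <= ln 2 + (ln (a j) - Re s / gamma)).
    { unfold L. rewrite <- (ln_exp (ln (a j) - Re s / gamma)), <- Cmod_power. fold w.
      rewrite Hp, <- ln_mult by lra. apply ln_le; [apply Hfac0|].
      specialize (Hfac j). lra. }
    apply Rmult_le_compat_l with (r := gamma) in H; [|lra].
    replace (gamma * (ln 2 + (ln (a j) - Re s / gamma))) with
      (gamma * ln 2 + gamma * ln (a j) - Re s) in H by (field; lra).
    lra. }
  assert (tail : Series (fun k => L (N + k)%nat) <= K * (INR N + 1)).
  { apply Rle_trans with (x * Series (fun k => a (N + k)%nat)).
    - rewrite <- Series_scal_l. apply Series_le.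
      + intros k; split; [apply HL0|]. unfold L.
        eapply Rle_trans; [apply ln_le; [apply Hfac0 | apply Hfac]|].
        (* This is [ln (1 + y) <= y], in the form [1 + y <= exp y]. *)
        destruct (Ha (N + k)%nat). rewrite <- (ln_exp (x * a (N + k)%nat)) at 2.
        apply ln_le; [nra | apply exp_ineq1_le].
      + apply (ex_series_scal_l (V := R_NormedModule) x).
        apply (ex_series_incr_n (V := R_NormedModule) a N), Hsum.
    - specialize (Htail N). pose proof (pos_INR N).
      apply Rle_trans with (K * (INR N + 1) * (x * a N)).
      + replace (K * (INR N + 1) * (x * a N)) with (x * (K * (INR N + 1) * a N)) by ring.
        apply Rmult_le_compat_l; lra.
      (* The choice of [N] enters here: [x * a N <= 1] frees the bound of [a N] and of [s]. *)
      + rewrite <- (Rmult_1_r (K * (INR N + 1))) at 2. apply Rmult_le_compat_l; [nra | lra]. }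
  assert (G : forall n k, (k + n = N)%nat ->
    (exp (- gamma * ln 2) * exp (Re s)) ^ n * M N * exp (- gamma * (K * (INR N + 1)))
      <= exp (- gamma * Series (fun j => L (k + j)%nat)) * M k).
  { induction n as [|n IH]; intros k Hk.
    - rewrite Nat.add_0_r in Hk. subst k. simpl pow. rewrite Rmult_1_l, Rmult_comm.
      apply Rmult_le_compat_r; [left; apply HMpos|]. apply exp_le_compat. nra.
    - rewrite Series_incr_1 by (apply (ex_series_incr_n (V := R_NormedModule) L k), HL).
      rewrite Nat.add_0_r, (Rmult_plus_distr_l (- gamma) (L k)), exp_plus.
      specialize (IH (S k) ltac:(lia)).
      rewrite (Series_ext _ (fun j => L (S k + j)%nat)) by (intros j; f_equal; lia).
      rewrite HMa in IH. specialize (step k ltac:(lia)).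
      set (T := exp (- gamma * Series (fun j => L (S k + j)%nat))) in *.
      assert (HT : 0 < T) by apply exp_pos.
      pose proof (HMpos k). set (q := exp (- gamma * ln 2) * exp (Re s)) in *.
      assert (Hq : 0 < q) by (unfold q; apply Rmult_lt_0_compat; apply exp_pos).
      apply Rle_trans with (q * (T * (exp (- gamma * ln (a k)) * M k))).
      + simpl pow. rewrite !Rmult_assoc. apply Rmult_le_compat_l; [lra|]. rewrite <- !Rmult_assoc.
        rewrite <- !Rmult_assoc in IH. exact IH.
      + replace (q * (T * (exp (- gamma * ln (a k)) * M k))) with
          (q * exp (- gamma * ln (a k)) * (T * M k)) by ring.
        replace (exp (- gamma * L k) * T * M k) with (exp (- gamma * L k) * (T * M k)) by ring.
        apply Rmult_le_compat_r; [nra | exact step]. }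
  specialize (G N 0%nat eq_refl). rewrite HM0, Rmult_1_r in G.
  eapply Rle_trans; [|exact G]. right.
  rewrite Rmult_plus_distr_l, exp_plus.
  replace (exp (- gamma * (K * (INR N + 1)))) with (exp (- gamma * K) * exp (- gamma * K) ^ N).
  - rewrite !Rpow_mult_distr. ring.
  - rewrite <- (Rpower_pow N) by apply exp_pos. unfold Rpower. rewrite ln_exp, <- exp_plus.
    f_equal. ring.
Qed.

End FlatFunction.

(** * Weights from the growth index *)

Lemma h_le (M : nat -> R) (t : R) (n : nat) : (forall j, 0 <= M j) -> 0 < t ->
  h M t <= t ^ n * M n.
Proof.
  intros HM Ht. unfold h. destruct (Rlt_dec 0 t) as [_|]; [|contradiction].
  pose proof (Inf_seq_correct (fun j => Finite (t ^ j * M j))) as H.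
  destruct (Inf_seq (fun j => Finite (t ^ j * M j))) as [l| |].
  - simpl. apply Rnot_lt_le. intros A.
    destruct (H (mkposreal (l - t ^ n * M n) ltac:(lra))) as [H1 _].
    specialize (H1 n). simpl in H1. lra.
  (* [real] sends [p_infty] to 0, so nonnegativity of the terms settles this case. *)
  - simpl. apply Rmult_le_pos; [left; apply pow_lt, Ht | apply HM].
  - destruct (H (-1)) as [j Hj]. simpl in Hj.
    assert (0 <= t ^ j * M j) by (apply Rmult_le_pos; [left; apply pow_lt, Ht | apply HM]). lra.
Qed.

Lemma le_h (M : nat -> R) (t x : R) : 0 < t -> (forall n, x <= t ^ n * M n) -> x <= h M t.
Proof.
  intros Ht Hx. unfold h. destruct (Rlt_dec 0 t) as [_|]; [|contradiction].
  pose proof (Inf_seq_correct (fun j => Finite (t ^ j * M j))) as H.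
  destruct (Inf_seq (fun j => Finite (t ^ j * M j))) as [l| |].
  - simpl. apply Rnot_lt_le. intros A.
    destruct (H (mkposreal (x - l) ltac:(lra))) as [_ [n Hn]].
    specialize (Hx n). simpl in Hn. lra.
  - specialize (H (t ^ 0 * M 0%nat) 0%nat). simpl in H. lra.
  - destruct (H x) as [j Hj]. specialize (Hx j). simpl in Hj. lra.
Qed.

Lemma bounded_partial_sums (u : nat -> R) (B : R) :
  (forall n, 0 <= u n) -> (forall n, sum_n u n <= B) -> ex_series u /\ Series u <= B.
Proof.
  intros Hu HB.
  assert (Hinc : forall n, sum_n u n <= sum_n u (S n)).
  { intros n. rewrite sum_Sn. unfold plus; simpl. specialize (Hu (S n)). lra. }
  destruct (ex_finite_lim_seq_incr (sum_n u) B Hinc HB) as [l Hl].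
  assert (Hs : is_series u l) by exact Hl.
  split; [exists l; exact Hs|].
  rewrite (is_series_unique u l Hs).
  exact (is_lim_seq_le (sum_n u) (fun _ => B) l B HB Hl (is_lim_seq_const B)).
Qed.

(** Comparison of a sum with an integral: by the mean value theorem the right-hand side is [c^(-mu)]
    for some [c] at most [y + 1]. In this form the bound telescopes. *)
Lemma Rpower_neg_step (y mu : R) : 0 < y -> 1 < mu ->
  Rpower (y + 1) (- mu) <= (Rpower y (1 - mu) - Rpower (y + 1) (1 - mu)) / (mu - 1).
Proof.
  intros Hy Hmu.
  destruct (MVT_gen (fun x => Rpower x (1 - mu)) y (y + 1)
    (fun x => (1 - mu) * Rpower x (- mu))) as [c [Hc E]].
  - intros x Hx. rewrite Rmin_left, Rmax_right in Hx by lra.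
    apply is_derive_Reals.
    replace (- mu) with (1 - mu - 1) by ring. apply derivable_pt_lim_power. lra.
  - intros x Hx. rewrite Rmin_left, Rmax_right in Hx by lra.
    apply derivable_continuous_pt. exists ((1 - mu) * Rpower x (1 - mu - 1)).
    apply derivable_pt_lim_power. lra.
  - rewrite Rmin_left, Rmax_right in Hc by lra.
    replace (y + 1 - y) with 1 in E by ring. rewrite Rmult_1_r in E.
    replace (Rpower y (1 - mu) - Rpower (y + 1) (1 - mu)) with
      ((mu - 1) * Rpower c (- mu)) by lra.
    replace ((mu - 1) * Rpower c (- mu) / (mu - 1)) with (Rpower c (- mu)) by (field; lra).
    unfold Rpower. apply exp_le_compat.
    assert (ln c <= ln (y + 1)) by (apply ln_le; lra). nra.
Qed.

Lemma sum_Rpower_neg_le (N n : nat) (mu : R) : 1 < mu ->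
  sum_n (fun k => Rpower (INR (N + k) + 1) (- mu)) n
    <= (INR N + 1) * Rpower (INR N + 1) (- mu) * (1 + / (mu - 1)).
Proof.
  intros Hmu. pose proof (pos_INR N) as HN.
  assert (Hi : 0 < / (mu - 1)) by (apply Rinv_0_lt_compat; lra).
  set (P := Rpower (INR N + 1) (- mu)).
  assert (HP : 0 < P) by apply exp_pos.
  assert (E : Rpower (INR N + 1) (1 - mu) = (INR N + 1) * P).
  { unfold P, Rminus. rewrite Rpower_plus, Rpower_1 by lra. reflexivity. }
  assert (G : sum_n (fun k => Rpower (INR (N + k) + 1) (- mu)) n
    <= P + (Rpower (INR N + 1) (1 - mu) - Rpower (INR (N + n) + 1) (1 - mu)) / (mu - 1)).
  { induction n as [|n IH].
    - rewrite sum_O, Nat.add_0_r. unfold P. right. unfold Rdiv. ring.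
    - rewrite sum_Sn. unfold plus; simpl.
      pose proof (pos_INR (N + n)).
      pose proof (Rpower_neg_step (INR (N + n) + 1) mu ltac:(lra) Hmu) as H1.
      replace (N + S n)%nat with (S (N + n)) by lia. rewrite S_INR.
      unfold Rdiv in *. lra. }
  eapply Rle_trans; [exact G|]. rewrite E.
  assert (0 < Rpower (INR (N + n) + 1) (1 - mu)) by apply exp_pos.
  unfold Rdiv. nra.
Qed.

(** * Tail sums of negative powers of the quotients *)

Section Quotients.

Variables (M : nat -> R) (gamma gamma' : R).
Hypothesis HM0 : M 0%nat = 1.
Hypothesis Hincr : forall j, M j <= M (S j).
Hypothesis Hgamma : 0 < gamma < gamma'.
Hypothesis HP : property_P M gamma'.

Lemma M_ge_1 (j : nat) : 1 <= M j.
Proof. induction j; [rewrite HM0; lra | eapply Rle_trans; [exact IHj | apply Hincr]]. Qed.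

Lemma quotient_ge_1 (j : nat) : 1 <= quotient M j.
Proof.
  unfold quotient. pose proof (M_ge_1 j). specialize (Hincr j).
  apply Rmult_le_reg_r with (M j); [lra|].
  unfold Rdiv. rewrite Rmult_assoc, Rinv_l by lra. lra.
Qed.

(** Monotonicity of [(j+1)^(-gamma') m'_j] between [N] and [N + k], in logarithms. Passing from [m]
    to [m'] and back costs [a] each time, so [c = a * a]. *)
Lemma quotient_growth : exists c, 1 <= c /\ forall N k,
  ln (quotient M N) + gamma' * (ln (INR (N + k) + 1) - ln (INR N + 1)) - ln c
    <= ln (quotient M (N + k)).
Proof.
  destruct HP as (m' & a & Ha & Hmono & Hm).
  exists (a * a). split; [nra|]. intros N k.
  assert (Hia : 0 < / a) by (apply Rinv_0_lt_compat; lra).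
  assert (Hm' : forall j, 0 < m' j).
  { intros j. destruct (Hm j) as [H _]. pose proof (quotient_ge_1 j). nra. }
  assert (Mono : Rpower (INR N + 1) (- gamma') * m' N
     <= Rpower (INR (N + k) + 1) (- gamma') * m' (N + k)%nat).
  { induction k as [|k IH]; [rewrite Nat.add_0_r; lra|].
    eapply Rle_trans; [exact IH|]. specialize (Hmono (N + k)%nat).
    rewrite <- plus_n_Sm. rewrite !plus_INR in Hmono. rewrite <- plus_INR in Hmono. exact Hmono. }
  assert (Log : - gamma' * ln (INR N + 1) + ln (m' N)
     <= - gamma' * ln (INR (N + k) + 1) + ln (m' (N + k)%nat)).
  { rewrite <- (ln_exp (- gamma' * ln (INR N + 1))), <- (ln_exp (- gamma' * ln (INR (N + k) + 1))).
    rewrite <- !ln_mult by (auto; apply exp_pos).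
    apply ln_le; [|exact Mono]. apply Rmult_lt_0_compat; [apply exp_pos | auto]. }
  pose proof (quotient_ge_1 N) as Q1. pose proof (quotient_ge_1 (N + k)) as Q2.
  assert (L1 : ln (quotient M N) - ln a <= ln (m' N)).
  { destruct (Hm N) as [H _]. replace (ln (quotient M N) - ln a) with (ln (/ a * quotient M N)).
    - apply ln_le; [nra | exact H].
    - rewrite ln_mult, ln_Rinv by lra. ring. }
  assert (L2 : ln (m' (N + k)%nat) <= ln a + ln (quotient M (N + k))).
  { destruct (Hm (N + k)%nat) as [_ H]. rewrite <- ln_mult by lra. apply ln_le; auto. }
  rewrite ln_mult by lra. lra.
Qed.

Definition weight (j : nat) : R := exp (- ln (quotient M j) / gamma).

Lemma weight_bounds (j : nat) : 0 < weight j <= 1.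
Proof.
  split; [apply exp_pos|]. unfold weight. rewrite <- exp_0. apply exp_le_compat.
  pose proof (quotient_ge_1 j) as H.
  assert (0 <= ln (quotient M j)) by (rewrite <- ln_1; apply ln_le; lra).
  assert (0 < / gamma) by (apply Rinv_0_lt_compat; lra). unfold Rdiv. nra.
Qed.

Lemma weight_step (j : nat) : M (S j) = exp (- gamma * ln (weight j)) * M j.
Proof.
  unfold weight. rewrite ln_exp.
  replace (- gamma * (- ln (quotient M j) / gamma)) with (ln (quotient M j)) by (field; lra).
  pose proof (quotient_ge_1 j). pose proof (M_ge_1 j). rewrite exp_ln by lra.
  unfold quotient. field. lra.
Qed.

(** The quotients grow at least like [(j+1)^gamma'] relative to index [N], so the weights decay like
    [((N+k+1)/(N+1))^(-mu)] with [mu = gamma' / gamma > 1], up to the factor [D = c^(1/gamma)].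
    Summing over [k] gives a multiple of [N + 1]. *)
Lemma weight_tail : exists K, 0 <= K /\ forall N,
  ex_series (fun k => weight (N + k)) /\
  Series (fun k => weight (N + k)) <= K * (INR N + 1) * weight N.
Proof.
  destruct quotient_growth as (c & Hc & H).
  set (mu := gamma' / gamma).
  assert (Hmu : 1 < mu).
  { unfold mu. apply Rmult_lt_reg_r with gamma; [lra|].
    unfold Rdiv. rewrite Rmult_assoc, Rinv_l by lra. lra. }
  assert (Hi : 0 < / (mu - 1)) by (apply Rinv_0_lt_compat; lra).
  set (D := exp (ln c / gamma)). assert (HD : 0 < D) by apply exp_pos.
  exists (D * (1 + / (mu - 1))). split; [nra|]. intros N.
  pose proof (pos_INR N) as HN.
  set (P := Rpower (INR N + 1) mu). assert (HPp : 0 < P) by apply exp_pos.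
  assert (HPi : P * Rpower (INR N + 1) (- mu) = 1).
  { unfold P. rewrite <- Rpower_plus. replace (mu + - mu) with 0 by ring. apply Rpower_O. lra. }
  destruct (weight_bounds N) as [W _].
  assert (Hw : forall k, weight (N + k) <= D * weight N * P * Rpower (INR (N + k) + 1) (- mu)).
  { intros k. unfold D, P, weight, Rpower. rewrite <- !exp_plus. apply exp_le_compat.
    specialize (H N k).
    assert (Hg : 0 < / gamma) by (apply Rinv_0_lt_compat; lra).
    apply Rmult_le_compat_r with (r := / gamma) in H; [|lra].
    unfold mu, Rdiv. lra. }
  apply bounded_partial_sums.
  - intros k. left. apply weight_bounds.
  - intros n.
    apply Rle_trans with (sum_n (fun k => D * weight N * P * Rpower (INR (N + k) + 1) (- mu)) n).
    + apply sum_n_m_le. exact Hw.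
    + replace (sum_n (fun k => D * weight N * P * Rpower (INR (N + k) + 1) (- mu)) n) with
        (D * weight N * P * sum_n (fun k => Rpower (INR (N + k) + 1) (- mu)) n)
        by (symmetry; exact (sum_n_mult_l (D * weight N * P)
              (fun k => Rpower (INR (N + k) + 1) (- mu)) n)).
      eapply Rle_trans.
      * apply Rmult_le_compat_l; [|apply sum_Rpower_neg_le, Hmu].
        apply Rmult_le_pos; [|lra]. apply Rmult_le_pos; lra.
      * right.
        replace (D * weight N * P * ((INR N + 1) * Rpower (INR N + 1) (- mu) * (1 + / (mu - 1))))
          with (D * weight N * (P * Rpower (INR N + 1) (- mu)) * (INR N + 1) * (1 + / (mu - 1))) by ring.
        rewrite HPi. ring.
Qed.

End Quotients.

(** Otherwise [gamma] would be an upper bound of the set whose least upper bound is the growth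
    index. *)
Lemma growth_index_gt (M : nat -> R) (gamma : R) :
  Rbar_lt gamma (growth_index M) -> exists gamma', gamma < gamma' /\ property_P M gamma'.
Proof.
  intros H. apply Classical_Prop.NNPP. intros N.
  apply (Rbar_lt_not_le _ _ H).
  apply (proj2 (Lub_Rbar_correct _)). intros x [_ Hx]. simpl.
  apply Rnot_lt_le. intros A. apply N. exists x; auto.
Qed.

(** * Nested strips and the choice of constants *)

Theorem theorem2p3p1 (M : nat -> R) (gamma : R)
    (HM : strongly_regular M)
    (Hgamma : 0 < gamma)
    (Hindex : Rbar_lt (Finite gamma) (growth_index M)) :
  exists (G : Sigma -> C) (kappa1 kappa2 kappa3 : R),
    ultraholomorphic M (sector gamma) G /\
    0 < kappa1 /\ 0 < kappa2 /\ 0 < kappa3 /\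
    forall z : Sigma, sector gamma z ->
      kappa1 * h M (kappa2 * modulus z) <= Cmod (G z) /\
      Cmod (G z) <= h M (kappa3 * modulus z).
Proof.
  destruct HM as (A & _ & (HM0 & Hincr) & _).
  destruct (growth_index_gt M gamma Hindex) as (gamma' & Hg' & HP).
  set (gam := (gamma + gamma') / 2).
  assert (Hgam : 0 < gam < gamma') by (unfold gam; lra).
  assert (Hgam0 : 0 < gam) by lra.
  assert (Hgg : gamma < gam) by (unfold gam; lra).
  pose proof PI_RGT_0 as Hpi.
  pose proof (M_ge_1 M HM0 Hincr) as HM1.
  assert (HMpos : forall j, 0 < M j) by (intros j; specialize (HM1 j); lra).
  set (a := weight M gam).
  pose proof (weight_bounds M gam gamma' HM0 Hincr Hgam : forall j, 0 < a j <= 1) as Ha.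
  pose proof (weight_step M gam gamma' HM0 Hincr Hgam) as HMa. fold a in HMa.
  destruct (weight_tail M gam gamma' HM0 Hincr Hgam HP) as (K & HK & HT). fold a in HT.
  assert (Hsum : ex_series a) by exact (proj1 (HT 0%nat)).
  set (g := flat a gam).
  assert (Hin : forall z, sector gamma z -> strip gam (log_coord z)).
  { intros z [_ Hz]. unfold strip, log_coord, Im; simpl. eapply Rlt_trans; [exact Hz|]. nra. }
  assert (Hexp : forall z, 0 < modulus z -> exp (Re (log_coord z)) = modulus z).
  { intros z Hz. unfold log_coord, Re; simpl. apply exp_ln, Hz. }
  (* radius of the Cauchy circles, relative to |z| *)
  set (delta := Rmin 1 ((gam - gamma) * PI / 4)).
  assert (Hdelta : 0 < delta).
  { unfold delta. apply Rmin_glb_lt; [lra|]. nra. }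
  destruct (clog_1_plus_small delta Hdelta) as (eps & Heps & Hsmall).
  assert (Hie : 0 < / eps) by (apply Rinv_0_lt_compat; lra).
  (* [g] is controlled on [V], its derivatives on [U]. The strip of [U] lies halfway between those
     of opening [gamma] and [gam], so both gaps equal [(gam - gamma) * PI / 4]. The outer gap holds
     the circles, the inner one a neighbourhood of each point of the sector; [delta] is at most
     either gap and at most the unit margin in [Re s]. *)
  set (V := fun R0 s => strip gam s /\ R0 <= Re s).
  set (U := fun R0 s => Rabs (Im s) < (gam + gamma) / 2 * PI / 2 /\ R0 + 1 <= Re s).
  assert (HUV : forall R0 s, U R0 s -> forall u, Cmod u <= eps -> V R0 (s + clog (1 + u))%C).
  { intros R0 s [Hs1 Hs2] u Hu. specialize (Hsmall u Hu).
    pose proof (re_le_Cmod (clog (1 + u))) as B1. pose proof (im_le_Cmod (clog (1 + u))) as B2.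
    assert (D1 : delta <= 1) by apply Rmin_l.
    assert (D2 : delta <= (gam - gamma) * PI / 4) by apply Rmin_r.
    split.
    - unfold strip. replace (Im (s + clog (1 + u))%C) with (Im s + Im (clog (1 + u))%C) by reflexivity.
      eapply Rle_lt_trans; [apply Rabs_triang|]. nra.
    - replace (Re (s + clog (1 + u))%C) with (Re s + Re (clog (1 + u))%C) by reflexivity.
      apply Rabs_le_between in B1. lra. }
  (* Subtracting 2 from the real part leaves a unit margin below [log_coord z] inside [U], and one
     more between [U] and [V]. *)
  assert (HzU : forall z, sector gamma z -> U (Re (log_coord z) - 2) (log_coord z)).
  { intros z [_ Hz]. split; [|lra]. unfold log_coord, Im; simpl. eapply Rlt_trans; [exact Hz|]. nra. }
  assert (HzU' : forall z, sector gamma z -> forall s,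
    Cmod (s - log_coord z) < Rmin 1 ((gam - gamma) * PI / 4) -> U (Re (log_coord z) - 2) s).
  { intros z [_ Hz] s Hs.
    assert (D1 : Cmod (s - log_coord z) < 1) by (eapply Rlt_le_trans; [exact Hs | apply Rmin_l]).
    assert (D2 : Cmod (s - log_coord z) < (gam - gamma) * PI / 4)
      by (eapply Rlt_le_trans; [exact Hs | apply Rmin_r]).
    pose proof (re_le_Cmod (s - log_coord z)) as B1. pose proof (im_le_Cmod (s - log_coord z)) as B2.
    change (Re (s - log_coord z)%C) with (Re s - Re (log_coord z)) in B1.
    change (Im (s - log_coord z)%C) with (Im s - Arg z) in B2.
    split.
    - replace (Im s) with (Arg z + (Im s - Arg z)) by ring.
      eapply Rle_lt_trans; [apply Rabs_triang|]. nra.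
    - apply Rabs_le_between in B1. lra. }
  assert (Bg : forall R0, bounded_on (V R0) g).
  { intros R0. exists 1; split; [lra|]. intros s [Hs _]. apply Cmod_flat_le_1; auto. }
  assert (Hder : forall f f' z, sector gamma z -> C11 (U (Re (log_coord z) - 2)) f f' ->
    is_Sderive (fun x => f (log_coord x)) z (f' (log_coord z) / cexp (log_coord z))%C).
  { intros f f' z Hz Hf.
    apply (C11_is_Sderive (U (Re (log_coord z) - 2)) f f' z delta); auto. apply Hz. }
  (* The cuts [R0] do not occur in [cauchy_derivative]: one global family of derivatives is defined,
     and the cut may vary with [z] when it is verified. *)
  set (D := fun n z => cauchy_derivative g eps n (log_coord z)).
  exists (fun z => g (log_coord z)), (exp (- gam * K)), (exp (- gam * (ln 2 + K))), 1.
  split; [split|].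
  - intros z Hz. destruct (C11_flat a gam Ha Hsum Hgam0 (Re (log_coord z) - 2)) as [g' Hg].
    eexists. apply (Hder g g' z Hz).
    apply C11_subset with (2 := Hg). intros s [Hs1 Hs2].
    split; [|lra]. unfold strip. nra.
  - exists D. split; [split|].
    + intros z Hz. destruct (C11_flat a gam Ha Hsum Hgam0 (Re (log_coord z) - 2)) as [g' Hg].
      apply (cauchy_derivative_0 (V (Re (log_coord z) - 2)) g g' eps Hg (Bg _) Heps).
      apply HUV, HzU, Hz.
    + intros j z Hz. destruct (C11_flat a gam Ha Hsum Hgam0 (Re (log_coord z) - 2)) as [g' Hg].
      pose proof (C11_cauchy_derivative (V (Re (log_coord z) - 2)) g g' eps Hg (Bg _) Heps
        (U (Re (log_coord z) - 2)) j (Re (log_coord z) - 1)) as HC.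
      replace (D (S j) z) with
        (cexp (log_coord z) * cauchy_derivative g eps (S j) (log_coord z) / cexp (log_coord z))%C
        by (unfold D; field; apply cexp_neq_0).
      apply (Hder (cauchy_derivative g eps j) (fun s => cexp s * cauchy_derivative g eps (S j) s)%C z Hz).
      apply HC.
      * intros s Hs. apply HUV, Hs.
      * intros s [_ Hs]. lra.
    (* On the disc around [z] the modulus is at most [exp delta * |z|], hence at most [exp 1 * |z|];
       its [j]-th power and the [(/ eps) ^ j] of Cauchy's estimate form [sigma ^ j]. *)
    + exists 2, (exp 1 / eps). split; [lra|]. split; [apply Rmult_lt_0_compat; [apply exp_pos | lra]|].
      intros j z Hz. destruct (C11_flat a gam Ha Hsum Hgam0 (Re (log_coord z) - 2)) as [g' Hg].
      eapply Rle_trans.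
      * apply (Cmod_cauchy_derivative_le (V (Re (log_coord z) - 2)) g g' eps Hg (Bg _) Heps
          (log_coord z) j (exp 1 ^ j * M j)).
        -- apply HUV, HzU, Hz.
        -- intros u Hu.
           pose proof (HUV _ _ (HzU z Hz) u Hu) as [HV _].
           (* The flatness bound is used with exponent [j], the order of the derivative, to match
              the [|z|^j] in the hypothesis of Cauchy's estimate. *)
           eapply Rle_trans; [apply (Cmod_flat_le a gam Ha Hsum Hgam0 M HM0 HMpos HMa _ j HV)|].
           rewrite <- Rmult_assoc, <- Rpow_mult_distr, <- exp_plus.
           apply Rmult_le_compat_r; [left; apply HMpos|].
           apply pow_incr. split; [left; apply exp_pos|]. apply exp_le_compat.
           replace (Re (log_coord z + clog (1 + u))%C) with (Re (log_coord z) + Re (clog (1 + u))%C)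
             by reflexivity.
           pose proof (Re_le_Cmod (clog (1 + u))). specialize (Hsmall u Hu).
           assert (delta <= 1) by apply Rmin_l. lra.
      * right. unfold Rdiv. rewrite !Rpow_mult_distr. ring.
  - split; [apply exp_pos|]. split; [apply exp_pos|]. split; [lra|].
    intros z Hz. pose proof (Hin z Hz) as Hs. destruct Hz as [Hz _]. split.
    + destruct (Cmod_flat_ge a gam Ha Hsum Hgam0 M HM0 HMpos HMa K HK (fun N => proj2 (HT N)) _ Hs)
        as [N HN].
      eapply Rle_trans; [|exact HN]. rewrite (Hexp z Hz).
      apply Rmult_le_compat_l; [left; apply exp_pos|].
      apply h_le; [intros j; left; apply HMpos|].
      apply Rmult_lt_0_compat; [apply exp_pos | exact Hz].
    + rewrite Rmult_1_l. apply le_h; [exact Hz|]. intros n.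
      rewrite <- (Hexp z Hz). apply (Cmod_flat_le a gam Ha Hsum Hgam0 M HM0 HMpos HMa _ n Hs).
Qed.
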